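(* Let $\beta_1\ne\beta_2$ and suppose that the perturbed (Heun type) equation is in a double resonance. Then the unfolded Stokes matrices $St_L(\varepsilon),St_R(\varepsilon)$ at the origin satisfy $$St_L(\varepsilon)=e^{2\pi i T_L},\qquad St_R(\varepsilon)=e^{2\pi i T_R}.$$
   Context: Perturbed equation: $L_{2,\varepsilon}(L_{1,\varepsilon}y)=0$, $0<\varepsilon<1$, $\sqrt\varepsilon>0$, whose first-order factors annihilate respectively $\Phi_1(x,\varepsilon)=\left(\frac{x-\sqrt\varepsilon}{x+\sqrt\varepsilon}\right)^{\frac{\beta_1}{2\sqrt\varepsilon}}\left(\frac{1/\sqrt\varepsilon+x}{1/\sqrt\varepsilon-x}\right)^{\frac{\gamma_1}{2\sqrt\varepsilon}}$, $\Phi_2(x,\varepsilon)=\frac{(x-\sqrt\varepsilon)^{\frac{\beta_2}{2\sqrt\varepsilon}-1}}{(x+\sqrt\varepsilon)^{\frac{\beta_2}{2\sqrt\varepsilon}+1}}\left(\frac{1/\sqrt\varepsilon+x}{1/\sqrt\varepsilon-x}\right)^{\frac{\gamma_2}{2\sqrt\varepsilon}}$. Here $\beta_j,\gamma_j\in\mathbb{C}$. Singular points: $x_R=\sqrt\varepsilon$, $x_L=-\sqrt\varepsilon$, $x_{RR}=1/\sqrt\varepsilon$, $x_{LL}=-1/\sqrt\varepsilon$. Double resonance: $\frac{\beta_2-\beta_1}{2\sqrt\varepsilon}$ and $\frac{\gamma_2-\gamma_1}{2\sqrt\varepsilon}$ are both integers, so $\Phi_2/\Phi_1$ is a rational function.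 $T_j=\begin{pmatrix}0&d_j\\0&0\end{pmatrix}$ with $d_j=\mathrm{Res}(\Phi_2/\Phi_1;x=x_j)$, $j=L,R$. Fundamental matrix at the origin: $\Phi_0(x,\varepsilon)=\begin{pmatrix}\Phi_1&\Phi_{12}\\0&\Phi_2\end{pmatrix}$ with $\Phi_{12}(x,\varepsilon)=\Phi_1(x,\varepsilon)\int_{x_*}^x\frac{\Phi_2(z,\varepsilon)}{\Phi_1(z,\varepsilon)}dz$, where the base point is $x_*=x_R$ if $\beta_2-\beta_1>0$ and $x_*=x_L$ if $\beta_1-\beta_2>0$ (the integral converges at $x_*$). Unfolded Stokes matrices. Fix $\rho$ with $\sqrt\varepsilon<\rho<1/\sqrt\varepsilon$. Let $\Omega_{1,0}(\varepsilon)$, $\Omega_{2,0}(\varepsilon)$ be two sectorial domains of radius $\rho$ at the origin covering $\{0<|x|<\rho\}$ cut along the real segment $[x_L,x_R]$: each is a half-disc slightly enlarged across the real axis beyond $x_L$ and beyond $x_R$; if $\beta_1-\beta_2>0$, $\Omega_{1,0}(\varepsilon)$ is the upper and $\Omega_{2,0}(\varepsilon)$ the lower one, and if $\beta_1-\beta_2<0$, $\Omega_{1,0}(\varepsilon)$ is the lower and $\Omega_{2,0}(\varepsilon)$ the upper one. Away from the cut they intersect in two components $\Omega_L(\varepsilon)$ (around real $x\in(-\rho,x_L)$) and $\Omega_R(\varepsilon)$ (around real $x\in(x_R,\rho)$). Let $\Psi_k^0(x,\varepsilon)$, $k=1,2$, be the branch of $\Phi_0(x,\varepsilon)$ on $\Omega_{k,0}(\varepsilon)$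 in which the integral is taken from $x_*$ to $x$ along a path inside $\Omega_{k,0}(\varepsilon)$, and in which the branches of $\Phi_1,\Phi_2$ on the two domains are chosen to coincide on the component adjacent to $x_*$ (they then also coincide on the other component). The unfolded Stokes matrix $St_j(\varepsilon)$, $j=L,R$, is defined on $\Omega_j(\varepsilon)$ by $St_j(\varepsilon)=(\Psi_1^0(x,\varepsilon))^{-1}\Psi_2^0(x,\varepsilon)$. *)

(* Defs.v *)
From Stdlib Require Import Reals ZArith Lia.
From Coquelicot Require Import Coquelicot.
Open Scope R_scope.

Definition Cexp (z : C) : C :=
  (RtoC (exp (Re z)) * (cos (Im z), sin (Im z)))%C.

Definition log_branch (U : C -> Prop) (g lambda : C -> C) : Prop :=
  forall x : C, U x ->
    @continuous C_UniformSpace C_UniformSpace lambda x /\ Cexp (lambda x) = g x.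

(** [f] is a branch of [g ^ alpha] on [U]. *)
Definition power_branch (U : C -> Prop) (g : C -> C) (alpha : C)
    (f : C -> C) : Prop :=
  exists lambda : C -> C, log_branch U g lambda /\
    forall x : C, U x -> f x = Cexp (alpha * lambda x)%C.

Definition mat2 (a b c d : C) : matrix 2 2 :=
  mk_matrix 2 2 (fun i j =>
    match i, j with
    | O, O => a | O, _ => b | _, O => c | _, _ => d
    end).

Definition entry (A : matrix 2 2) (i j : nat) : C :=
  coeff_mat (RtoC 0) A i j.

Definition mat2_scal (c : C) (A : matrix 2 2) : matrix 2 2 :=
  mk_matrix 2 2 (fun i j => (c * entry A i j)%C).

Definition det2 (A : matrix 2 2) : C :=
  (entry A 0 0 * entry A 1 1 - entry A 0 1 * entry A 1 0)%C.

Definition Minv2 (A : matrix 2 2) : matrix 2 2 :=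
  mat2 (entry A 1 1 / det2 A)%C (- entry A 0 1 / det2 A)%C
       (- entry A 1 0 / det2 A)%C (entry A 0 0 / det2 A)%C.

Lemma mat2_eta (A : matrix 2 2) :
  A = mat2 (entry A 0 0) (entry A 0 1) (entry A 1 0) (entry A 1 1).
Proof.
  destruct A as [[a [b u]] [[c [d v]] w]].
  destruct u, v, w; reflexivity.
Qed.

Lemma Mmult_mat2 (a b c d a' b' c' d' : C) :
  Mmult (T := C_Ring) (mat2 a b c d) (mat2 a' b' c' d') =
  mat2 (a * a' + b * c')%C (a * b' + b * d')%C
       (c * a' + d * c')%C (c * b' + d * d')%C.
Proof.
  apply mk_matrix_ext; intros i j Hi Hj.
  change (Init.Nat.pred 2) with 1%nat.
  rewrite sum_Sn, sum_O.
  now destruct i as [|[|i]], j as [|[|j]]; try lia.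
Qed.

Lemma Minv2_l (A : matrix 2 2) : det2 A <> RtoC 0 ->
  Mmult (T := C_Ring) (Minv2 A) A = mat2 1 0 0 1.
Proof.
  intros HA.
  rewrite (mat2_eta A) at 2; unfold Minv2; rewrite Mmult_mat2.
  unfold det2 in *; f_equal; field; exact HA.
Qed.

(** Entrywise sum of the series [A ^ k / k!]. *)
Definition mexp (A : matrix 2 2) : matrix 2 2 :=
  mk_matrix 2 2 (fun i j =>
    iota (T := C_R_CompleteNormedModule) (fun l : C =>
      is_series (V := C_R_NormedModule)
        (fun k => (entry (pow_n (K := @matrix_Ring C_Ring 2) A k) i j
                   / RtoC (INR (fact k)))%C) l)).

(** [gamma] is a path starting at [a] (possibly a boundary point of [U]),
    ending at [x], continuously differentiable and inside [U] after [a]. *)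
Definition is_path (U : C -> Prop) (a x : C) (gamma dgamma : R -> C) : Prop :=
  gamma 0 = a /\ gamma 1 = x /\
  filterlim gamma (at_right 0) (@locally C_UniformSpace a) /\
  forall t : R, 0 < t <= 1 ->
    U (gamma t) /\
    is_derive (V := C_R_NormedModule) gamma t (dgamma t) /\
    @continuous R_UniformSpace C_UniformSpace dgamma t.

Definition is_path_integral (U : C -> Prop) (q : C -> C) (a x v : C) : Prop :=
  exists gamma dgamma : R -> C, is_path U a x gamma dgamma /\
    is_RInt_gen (V := C_R_NormedModule)
      (fun t => (q (gamma t) * dgamma t)%C) (at_right 0) (at_point 1) v.

Definition path_integral (U : C -> Prop) (q : C -> C) (a x : C) : C :=
  iota (T := C_R_CompleteNormedModule) (is_path_integral U q a x).

Definition polynomial (n : nat) (p : nat -> C) (x : C) : C :=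
  sum_n (G := C_AbelianMonoid) (fun k => (p k * Cpow x k)%C) n.

Definition is_rational (Q : C -> C) : Prop :=
  exists (m n : nat) (p d : nat -> C),
    (exists k : nat, (k <= n)%nat /\ d k <> RtoC 0) /\
    forall x : C, Q x = (polynomial m p x / polynomial n d x)%C.

Definition is_residue (Q : C -> C) (a d : C) : Prop :=
  exists r0 : R, 0 < r0 /\ forall r : R, 0 < r < r0 ->
    is_RInt (V := C_R_NormedModule)
      (fun t => let w := (RtoC r * Cexp (Ci * RtoC t))%C in
                (Q (a + w) * (Ci * w))%C)
      0 (2 * PI) (RtoC (2 * PI) * Ci * d)%C.

(** Residue at [a] of the rational function which coincides with [q] on the
    domain [U]; the point [a] need not belong to [U]. *)
Definition Res (U : C -> Prop) (q : C -> C) (a : C) : C :=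
  iota (T := C_R_CompleteNormedModule) (fun d : C =>
    exists Q : C -> C, is_rational Q /\ (forall x : C, U x -> Q x = q x) /\
      is_residue Q a d).

Definition xR (eps : R) : R := sqrt eps.
Definition xL (eps : R) : R := - sqrt eps.
Definition xRR (eps : R) : R := 1 / sqrt eps.

Definition Phi1_branch (eps : R) (b1 g1 : C) (U : C -> Prop)
    (phi : C -> C) : Prop :=
  exists f h : C -> C,
    power_branch U (fun x => (x - xR eps) / (x + xR eps))%C
      (b1 / RtoC (2 * sqrt eps))%C f /\
    power_branch U (fun x => (xRR eps + x) / (xRR eps - x))%C
      (g1 / RtoC (2 * sqrt eps))%C h /\
    forall x : C, U x -> phi x = (f x * h x)%C.

Definition Phi2_branch (eps : R) (b2 g2 : C) (U : C -> Prop)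
    (phi : C -> C) : Prop :=
  exists f1 f2 h : C -> C,
    power_branch U (fun x => x - xR eps)%C
      (b2 / RtoC (2 * sqrt eps) - 1)%C f1 /\
    power_branch U (fun x => x + xR eps)%C
      (b2 / RtoC (2 * sqrt eps) + 1)%C f2 /\
    power_branch U (fun x => (xRR eps + x) / (xRR eps - x))%C
      (g2 / RtoC (2 * sqrt eps))%C h /\
    forall x : C, U x -> phi x = (f1 x / f2 x * h x)%C.

Definition double_resonance (eps : R) (b1 b2 g1 g2 : C) : Prop :=
  (exists m : Z, ((b2 - b1) / RtoC (2 * sqrt eps))%C = RtoC (IZR m)) /\
  (exists n : Z, ((g2 - g1) / RtoC (2 * sqrt eps))%C = RtoC (IZR n)).

(** The half-discs of radius [rho], enlarged across the real axis beyond [xL]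
    and [xR] by sectors of slope [delta] with vertices [xL] and [xR]. *)
Definition Omega_up (eps rho delta : R) (x : C) : Prop :=
  Cmod x < rho /\ - (delta * Rmax 0 (Rabs (Re x) - sqrt eps)) < Im x.

Definition Omega_down (eps rho delta : R) (x : C) : Prop :=
  Cmod x < rho /\ Im x < delta * Rmax 0 (Rabs (Re x) - sqrt eps).

(** In a double resonance [b2 - b1] is real, so that its sign is that of its
    real part. *)
Definition Omega1 (eps rho delta : R) (b1 b2 : C) : C -> Prop :=
  if Rlt_dec 0 (Re (b1 - b2)%C)
  then Omega_up eps rho delta else Omega_down eps rho delta.

Definition Omega2 (eps rho delta : R) (b1 b2 : C) : C -> Prop :=
  if Rlt_dec 0 (Re (b1 - b2)%C)
  then Omega_down eps rho delta else Omega_up eps rho delta.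

Definition Omega_L (eps rho delta : R) (b1 b2 : C) (x : C) : Prop :=
  Omega1 eps rho delta b1 b2 x /\ Omega2 eps rho delta b1 b2 x /\
  Re x < xL eps.

Definition Omega_R (eps rho delta : R) (b1 b2 : C) (x : C) : Prop :=
  Omega1 eps rho delta b1 b2 x /\ Omega2 eps rho delta b1 b2 x /\
  xR eps < Re x.

Definition base_point (eps : R) (b1 b2 : C) : R :=
  if Rlt_dec 0 (Re (b2 - b1)%C) then xR eps else xL eps.

(** The component of the intersection adjacent to the base point. *)
Definition Omega_base (eps rho delta : R) (b1 b2 : C) : C -> Prop :=
  if Rlt_dec 0 (Re (b2 - b1)%C)
  then Omega_R eps rho delta b1 b2 else Omega_L eps rho delta b1 b2.

(** Fundamental matrix on [U] built on the branches [phi1], [phi2], with the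
    integral taken from [a]. *)
Definition Psi (U : C -> Prop) (phi1 phi2 : C -> C) (a x : C) : matrix 2 2 :=
  mat2 (phi1 x)
       (phi1 x * path_integral U (fun z => phi2 z / phi1 z)%C a x)%C
       0 (phi2 x).

Definition Stokes (Psi1 Psi2 : C -> matrix 2 2) (x : C) : matrix 2 2 :=
  Mmult (T := C_Ring) (Minv2 (Psi1 x)) (Psi2 x).

Definition Tmat (d : C) : matrix 2 2 := mat2 0 d 0 0.

Definition exp_2piT (d : C) : matrix 2 2 :=
  mexp (mat2_scal (RtoC (2 * PI) * Ci)%C (Tmat d)).

(* Main.v *)
Require Import Defs.
From Stdlib Require Import Reals ZArith Lra Lia Psatz Ranalysis5 Classical.
From Stdlib Require Import FunctionalExtensionality PropExtensionality.
From Coquelicot Require Import Coquelicot.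
Open Scope R_scope.

(** On each half-disc the branches of [Phi_1], [Phi_2] are constants times
    exponentials of combinations of the principal logarithms of
    [(x - s) / (x + s)] and [(X + x) / (X - x)], with [s = sqrt eps] and
    [X = 1 / s].  Both logarithms are single valued on the union of the two
    half-discs, so branches that agree near the base point [a] agree throughout.
    In a double resonance [Phi_2 / Phi_1] is then one rational function,
    regular at [a = +-s], with a single pole [p = - a] in the disc.  By partial
    fractions it equals [d / (x - p) + G'] with [G] single valued, so
    its integrals over the two half-discs are the increments of
    [G + d log (x - p)] for two logarithms whose cuts point away from the
    respective half-disc.  These logarithms agree on the side of [a] and differ
    by [2 pi i] on the other side; hence the two integrals differ by
    [2 pi i d] near [p] and by [0] near [a], where [d] and [0] are the residues. *)

(** * Componentwise calculus for complex-valued functions *)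

(** Integrals and residues are descriptions by [iota], so each value needs existence and uniqueness.

    For integrals, a single-valued primitive gives uniqueness over all admissible paths. Existence
    asks for an explicit path inside the half-disc; the hard case is an end point in the thin sector
    beyond the far end of the cut, possibly below the real axis, and it is the reason for the conic.
    For residues, uniqueness means that two rational functions equal on the half-disc agree on a
    punctured neighbourhood of a point outside it.

    No contour theorem enters: primitives are differentiated along real curves, and partial
    fractions show that the logarithm at [p] is the sole obstruction to a single-valued primitive on
    the disc punctured at [p].

    Three signs merge the symmetric cases: [tau] selects the upper or lower half-disc, [alpha] is
    the sign of [b2 - b1] (base point [alpha s], inner pole [- alpha s]), and [es] tells which of
    the outer points [+-X] may be a pole. *)

Lemma filterlim_C_pair {T : Type} (F : (T -> Prop) -> Prop) {FF : Filter F}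
    (f : T -> C) (l : C) :
  filterlim f F (@locally C_UniformSpace l) <->
  filterlim (fun t => fst (f t)) F (locally (fst l)) /\
  filterlim (fun t => snd (f t)) F (locally (snd l)).
Proof.
  split.
  - intros H; split; intros P [e He].
    + apply (H (fun z => P (fst z))); exists e; intros z [Hz _]; now apply He.
    + apply (H (fun z => P (snd z))); exists e; intros z [_ Hz]; now apply He.
  - intros [H1 H2] P [e He].
    assert (H1' := H1 _ (locally_ball (fst l) e)).
    assert (H2' := H2 _ (locally_ball (snd l) e)).
    unfold filtermap in *.
    generalize (filter_and _ _ H1' H2'); apply filter_imp.
    intros t [A B]; apply He; split; assumption.
Qed.

Lemma continuous_C_pair {U : UniformSpace} (f : U -> C) (x : U) :
  @continuous U C_UniformSpace f x <->
  continuous (fun t => fst (f t)) x /\ continuous (fun t => snd (f t)) x.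
Proof. unfold continuous; apply filterlim_C_pair; apply locally_filter. Qed.

(** From components to [C]: the Euclidean norm of the remainder is at most the sum of the absolute
    values of its components, and each component receives half of [e]. *)
Lemma is_derive_C_pair (f : R -> C) (t : R) (l : C) :
  is_derive (V := C_R_NormedModule) f t l <->
  is_derive (fun u => fst (f u)) t (fst l) /\
  is_derive (fun u => snd (f u)) t (snd l).
Proof.
  split.
  - intros H; split.
    + apply (filterdiff_comp f (fun z : C_R_NormedModule => fst z)
        (fun y : R => scal y l) (fun z : C_R_NormedModule => fst z)); auto.
      apply filterdiff_linear, is_linear_fst.
    + apply (filterdiff_comp f (fun z : C_R_NormedModule => snd z)
        (fun y : R => scal y l) (fun z : C_R_NormedModule => snd z)); auto.
      apply filterdiff_linear, is_linear_snd.
  - intros [[_ H1] [_ H2]]; split.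
    { apply (is_linear_scal_l (K := R_AbsRing) (V := C_R_NormedModule) l). }
    intros x Hx; specialize (H1 x Hx); specialize (H2 x Hx).
    intros e.
    assert (He : 0 < e / 2) by (destruct e; simpl; lra).
    specialize (H1 (mkposreal _ He)); specialize (H2 (mkposreal _ He)).
    generalize (filter_and _ _ H1 H2); apply filter_imp; clear H1 H2.
    intros u [A B]; simpl in A, B.
    set (z := minus (minus (f u) (f x)) (scal (minus u x) l) : C).
    change (sqrt (Rabs (fst z) ^ 2 + Rabs (snd z) ^ 2) <= e * norm (minus u x)).
    apply Rle_trans with (Rabs (fst z) + Rabs (snd z)).
    + assert (P := Rabs_pos (fst z)); assert (P' := Rabs_pos (snd z)).
      rewrite <- (sqrt_Rsqr (Rabs (fst z) + Rabs (snd z))) by lra.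
      apply sqrt_le_1_alt; unfold Rsqr; nra.
    + replace (e * norm (minus u x)) with (e / 2 * norm (minus u x) + e / 2 * norm (minus u x)) by field.
      apply Rplus_le_compat; [exact A | exact B].
Qed.

Section Continuity.
Context {U : UniformSpace}.
Implicit Types f g : U -> C.
Local Notation ccont f x := (@continuous U C_UniformSpace f x).

Lemma continuous_Cplus f g x :
  ccont f x -> ccont g x -> ccont (fun t => f t + g t)%C x.
Proof.
  rewrite !continuous_C_pair; intros [A B] [A' B']; simpl; split.
  - apply (continuous_plus (V := R_NormedModule)); assumption.
  - apply (continuous_plus (V := R_NormedModule)); assumption.
Qed.

Lemma continuous_Copp f x : ccont f x -> ccont (fun t => - f t)%C x.
Proof.
  rewrite !continuous_C_pair; intros [A B]; simpl; split.
  - apply (continuous_opp (V := R_NormedModule)); assumption.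
  - apply (continuous_opp (V := R_NormedModule)); assumption.
Qed.

Lemma continuous_Cminus f g x :
  ccont f x -> ccont g x -> ccont (fun t => f t - g t)%C x.
Proof. intros A B; apply continuous_Cplus, continuous_Copp; assumption. Qed.

Lemma continuous_Cmult f g x :
  ccont f x -> ccont g x -> ccont (fun t => f t * g t)%C x.
Proof.
  rewrite !continuous_C_pair; intros [A B] [A' B']; simpl; split.
  - apply (continuous_minus (V := R_NormedModule));
      apply (continuous_mult (K := R_AbsRing)); assumption.
  - apply (continuous_plus (V := R_NormedModule));
      apply (continuous_mult (K := R_AbsRing)); assumption.
Qed.

Lemma Rsqr_Cmod_neq_0 (z : C) : z <> 0%C -> 0 < fst z ^ 2 + snd z ^ 2.
Proof.
  intros Hz; destruct z as [u v]; simpl.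
  destruct (Req_dec u 0) as [->|Hu]; [|nra].
  destruct (Req_dec v 0) as [->|Hv]; [|nra].
  now contradiction Hz.
Qed.

Lemma continuous_Rinv_fun (f : U -> R) x :
  continuous f x -> f x <> 0 -> continuous (fun t => / f t) x.
Proof.
  intros Hf Hx; apply (continuous_comp f Rinv); auto.
  apply continuity_pt_filterlim, continuity_pt_inv; auto.
  apply continuity_pt_id.
Qed.

Lemma continuous_Cinv f x : ccont f x -> f x <> 0%C -> ccont (fun t => / f t)%C x.
Proof.
  rewrite !continuous_C_pair; intros [A B] Hx; simpl.
  assert (N := Rsqr_Cmod_neq_0 _ Hx).
  assert (D : continuous (fun t => / (fst (f t) ^ 2 + snd (f t) ^ 2)) x).
  { apply continuous_Rinv_fun; [|lra].
    simpl; apply (continuous_plus (V := R_NormedModule));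
      repeat apply (continuous_mult (K := R_AbsRing)); auto; apply continuous_const. }
  split.
  - apply (continuous_mult (K := R_AbsRing)); assumption.
  - apply (continuous_mult (K := R_AbsRing)); auto.
    now apply (continuous_opp (V := R_NormedModule)).
Qed.

Lemma continuous_Cdiv f g x :
  ccont f x -> ccont g x -> g x <> 0%C -> ccont (fun t => f t / g t)%C x.
Proof. intros; apply continuous_Cmult, continuous_Cinv; assumption. Qed.

Lemma continuous_Cpow f n x : ccont f x -> ccont (fun t => f t ^ n)%C x.
Proof.
  intros A; induction n as [|n IH]; simpl.
  - apply continuous_const.
  - now apply continuous_Cmult.
Qed.

End Continuity.

Definition cderiv (f : R -> C) (t : R) (l : C) : Prop :=
  is_derive (V := C_R_NormedModule) f t l.

Lemma is_derive_C_const (c : C) (t : R) : cderiv (fun _ => c) t 0%C.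
Proof. apply (is_derive_const (V := C_R_NormedModule)). Qed.

Lemma is_derive_Cplus (f g : R -> C) t l m :
  cderiv f t l -> cderiv g t m -> cderiv (fun u => f u + g u)%C t (l + m)%C.
Proof. apply (is_derive_plus (V := C_R_NormedModule)). Qed.

Lemma is_derive_Cmult (f g : R -> C) t l m :
  cderiv f t l -> cderiv g t m ->
  cderiv (fun u => f u * g u)%C t (l * g t + f t * m)%C.
Proof.
  unfold cderiv; rewrite !is_derive_C_pair; intros [A B] [A' B'].
  set (f1 := fun u : R => fst (f u)); set (f2 := fun u : R => snd (f u)).
  set (g1 := fun u : R => fst (g u)); set (g2 := fun u : R => snd (g u)).
  change (is_derive (fun x : R => f1 x) t (fst l)) in A; change (is_derive (fun x : R => f2 x) t (snd l)) in B.
  change (is_derive (fun x : R => g1 x) t (fst m)) in A'; change (is_derive (fun x : R => g2 x) t (snd m)) in B'.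
  split.
  - change (is_derive (fun u : R => f1 u * g1 u - f2 u * g2 u) t
      (fst l * g1 t - snd l * g2 t + (f1 t * fst m - f2 t * snd m))).
    auto_derive.
    { repeat split; eexists; eassumption. }
    rewrite (is_derive_unique _ _ _ A), (is_derive_unique _ _ _ B),
      (is_derive_unique _ _ _ A'), (is_derive_unique _ _ _ B'); ring.
  - change (is_derive (fun u : R => f1 u * g2 u + f2 u * g1 u) t
      (fst l * g2 t + snd l * g1 t + (f1 t * snd m + f2 t * fst m))).
    auto_derive.
    { repeat split; eexists; eassumption. }
    rewrite (is_derive_unique _ _ _ A), (is_derive_unique _ _ _ B),
      (is_derive_unique _ _ _ A'), (is_derive_unique _ _ _ B'); ring.
Qed.

Lemma is_derive_Cinv (f : R -> C) t l :
  f t <> 0%C -> cderiv f t l -> cderiv (fun u => / f u)%C t (- l / (f t * f t))%C.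
Proof.
  intros Hx; unfold cderiv; rewrite !is_derive_C_pair; intros [A B].
  assert (N := Rsqr_Cmod_neq_0 _ Hx).
  destruct l as [p q].
  set (f1 := fun u : R => fst (f u)); set (f2 := fun u : R => snd (f u)).
  change (is_derive (fun x : R => f1 x) t p) in A; change (is_derive (fun x : R => f2 x) t q) in B.
  change (fst (f t)) with (f1 t) in N; change (snd (f t)) with (f2 t) in N.
  assert (E : (- (p, q) / (f t * f t))%C = (- (p, q) / ((f1 t, f2 t) * (f1 t, f2 t)))%C).
  { unfold f1, f2; now rewrite <- surjective_pairing. }
  rewrite E; clear E.
  split.
  - change (is_derive (fun u : R => f1 u / (f1 u ^ 2 + f2 u ^ 2)) t
      (fst (- (p, q) / ((f1 t, f2 t) * (f1 t, f2 t)))%C)).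
    auto_derive.
    { repeat split; try (eexists; eassumption); simpl in N; lra. }
    rewrite (is_derive_unique _ _ _ A), (is_derive_unique _ _ _ B).
    simpl; field; nra.
  - change (is_derive (fun u : R => - f2 u / (f1 u ^ 2 + f2 u ^ 2)) t
      (snd (- (p, q) / ((f1 t, f2 t) * (f1 t, f2 t)))%C)).
    auto_derive.
    { repeat split; try (eexists; eassumption); simpl in N; lra. }
    rewrite (is_derive_unique _ _ _ A), (is_derive_unique _ _ _ B).
    simpl; field; nra.
Qed.

Lemma cderiv_ext (f g : R -> C) (t : R) (l : C) :
  (forall u, f u = g u) -> cderiv f t l -> cderiv g t l.
Proof. intros E; apply (is_derive_ext (V := C_R_NormedModule)); exact E. Qed.

Lemma Cminus_neq_0 (x e : C) : x <> e -> (x - e)%C <> 0%C.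
Proof.
  intros H E; apply H; replace x with (x - e + e)%C by ring; rewrite E; ring.
Qed.

(** * Complex exponential and logarithms *)

Lemma Cexp_add (z w : C) : Cexp (z + w)%C = (Cexp z * Cexp w)%C.
Proof.
  destruct z as [x y], w as [u v]; unfold Cexp; simpl.
  rewrite exp_plus, cos_plus, sin_plus.
  unfold Cmult; simpl; f_equal; ring.
Qed.

Lemma Cexp_0 : Cexp 0%C = 1%C.
Proof.
  unfold Cexp; simpl; rewrite exp_0, cos_0, sin_0.
  unfold Cmult, RtoC; simpl; f_equal; ring.
Qed.

Lemma Cexp_neq_0 (z : C) : Cexp z <> 0%C.
Proof.
  intros H; assert (E : RtoC 1 = RtoC 0).
  { rewrite <- Cexp_0, <- (Cplus_opp_r z), Cexp_add, H; ring. }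
  injection E; lra.
Qed.

Lemma Cexp_opp (z : C) : Cexp (- z)%C = (/ Cexp z)%C.
Proof.
  assert (H := Cexp_neq_0 z).
  rewrite <- (Cmult_1_l (Cexp (- z)%C)), <- (Cinv_l _ H), <- Cmult_assoc, <- Cexp_add.
  rewrite Cplus_opp_r, Cexp_0; ring.
Qed.

Lemma Cexp_eq_1 (z : C) :
  Cexp z = 1%C -> exists k : Z, z = (RtoC (2 * PI * IZR k) * Ci)%C.
Proof.
  destruct z as [x y]; unfold Cexp, Cmult, RtoC; simpl; intros H.
  injection H as H1 H2.
  assert (E := exp_pos x).
  assert (S : sin y = 0) by nra.
  assert (Q := sin2_cos2 y); unfold Rsqr in Q; rewrite S in Q.
  assert (Cy : cos y = 1) by nra.
  assert (X : exp x = exp 0) by (rewrite exp_0; nra).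
  apply exp_inv in X; subst x.
  (* The zeros of sine at [y] would only give multiples of pi; the half angle, through
     [cos y = 1 - 2 sin^2 (y / 2)], gives multiples of [2 pi]. *)
  assert (S2 : sin (y / 2) = 0).
  { assert (D := cos_2a_sin (y / 2)).
    replace (2 * (y / 2)) with y in D by field; nra. }
  apply sin_eq_0_0 in S2; destruct S2 as [k Hk].
  exists k; unfold Ci; simpl; f_equal; lra.
Qed.

Definition slit (z : C) : Prop := 0 < fst z \/ snd z <> 0.

(** Principal logarithm. The half-angle formula [arg = 2 atan (y / (r + x))] is valid on the whole
    plane slit along the nonpositive reals, so no distinction of quadrants arises in continuity or
    differentiation. *)
Definition Clog (z : C) : C :=
  (ln (fst z ^ 2 + snd z ^ 2) / 2,
   2 * atan (snd z / (sqrt (fst z ^ 2 + snd z ^ 2) + fst z))).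

Lemma slit_neq_0 (z : C) : slit z -> z <> 0%C.
Proof. intros H E; subst; destruct H as [H|H]; simpl in H; lra. Qed.

Lemma slit_pos (x y : R) : slit (x, y) ->
  0 < x ^ 2 + y ^ 2 /\ 0 < sqrt (x ^ 2 + y ^ 2) /\
  sqrt (x ^ 2 + y ^ 2) ^ 2 = x ^ 2 + y ^ 2 /\ 0 < sqrt (x ^ 2 + y ^ 2) + x.
Proof.
  intros H.
  assert (N := Rsqr_Cmod_neq_0 _ (slit_neq_0 _ H)); cbv beta iota delta [fst snd] in N.
  assert (P := sqrt_lt_R0 _ N).
  assert (E := pow2_sqrt _ (Rlt_le _ _ N)).
  repeat split; auto.
  destruct H as [H|H]; simpl in H; nra.
Qed.

Lemma Cexp_Clog (z : C) : slit z -> Cexp (Clog z) = z.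
Proof.
  destruct z as [x y]; intros H.
  destruct (slit_pos _ _ H) as [N [P [E Q]]].
  unfold Cexp, Clog; cbv beta iota delta [fst snd Re Im].
  set (r := sqrt (x ^ 2 + y ^ 2)) in *; rewrite <- E.
  assert (L : exp (ln (r ^ 2) / 2) = r).
  { simpl; rewrite Rmult_1_r, ln_mult by auto.
    replace ((ln r + ln r) / 2) with (ln r) by field; now apply exp_ln. }
  rewrite L, cos_2a_cos, sin_2a, cos_atan, sin_atan.
  set (t := y / (r + x)).
  (* From [y^2 = r^2 - x^2]; this is the quantity under the root in the cosine and sine of
     [atan t]. *)
  assert (T : 1 + t ^ 2 = 2 * r / (r + x)).
  { unfold t; apply (Rmult_eq_reg_r ((r + x) ^ 2)); [|nra].
    field_simplify; nra. }
  assert (TP : 0 < 2 * r / (r + x)) by (apply Rdiv_lt_0_compat; lra).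
  replace (1 + t²) with (2 * r / (r + x)) by (rewrite <- T; unfold Rsqr; ring).
  assert (S := pow2_sqrt _ (Rlt_le _ _ TP)).
  assert (S0 := sqrt_lt_R0 _ TP).
  set (q := sqrt (2 * r / (r + x))) in *.
  assert (I : / q * / q = (r + x) / (2 * r)).
  { rewrite <- Rinv_mult; replace (q * q) with (q ^ 2) by ring.
    rewrite S; field; lra. }
  unfold Cmult, RtoC; simpl; f_equal.
  - replace (2 * (1 / q) * (1 / q)) with (2 * (/ q * / q)) by (field; lra).
    rewrite I; field; lra.
  - replace (2 * (t / q) * (1 / q)) with (2 * t * (/ q * / q)) by (field; lra).
    rewrite I; unfold t; field; lra.
Qed.

Lemma continuous_Clog (z : C) :
  slit z -> @continuous C_UniformSpace C_UniformSpace Clog z.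
Proof.
  intros H; apply continuous_C_pair; destruct z as [x y].
  destruct (slit_pos _ _ H) as [N [P [E Q]]].
  assert (N2 : continuous (fun t : R * R => fst t ^ 2 + snd t ^ 2) (x, y)).
  { apply (continuous_plus (V := R_NormedModule));
      repeat apply (continuous_mult (K := R_AbsRing));
      try apply continuous_fst; try apply continuous_snd; apply continuous_const. }
  unfold Clog; cbv beta iota delta [fst snd] in *; split.
  - apply (continuous_mult (K := R_AbsRing)); [|apply continuous_const].
    apply (continuous_comp (fun t : R * R => fst t ^ 2 + snd t ^ 2) ln); auto.
    now apply continuous_ln.
  - apply (continuous_mult (K := R_AbsRing)); [apply continuous_const|].
    apply (continuous_comp (fun t : R * R => snd t / (sqrt (fst t ^ 2 + snd t ^ 2) + fst t)) atan);
      [|apply continuous_atan].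
    apply (continuous_mult (K := R_AbsRing)); [apply continuous_snd|].
    apply (continuous_Rinv_fun (U := C_UniformSpace)
      (fun t : R * R => sqrt (fst t ^ 2 + snd t ^ 2) + fst t)); [|simpl in *; lra].
    apply (continuous_plus (V := R_NormedModule)); [|apply continuous_fst].
    apply (continuous_comp (fun t : R * R => fst t ^ 2 + snd t ^ 2) sqrt); auto.
    apply continuous_sqrt.
Qed.

Lemma is_derive_Clog (f : R -> C) (t : R) (l : C) :
  slit (f t) -> cderiv f t l -> cderiv (fun u => Clog (f u)) t (l / f t)%C.
Proof.
  intros Hx; unfold cderiv; rewrite !is_derive_C_pair; intros [A B].
  destruct l as [p q].
  set (f1 := fun u : R => fst (f u)); set (f2 := fun u : R => snd (f u)).
  change (is_derive (fun x : R => f1 x) t p) in A.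
  change (is_derive (fun x : R => f2 x) t q) in B.
  rewrite (surjective_pairing (f t)) in Hx |- *.
  change (fst (f t)) with (f1 t) in *; change (snd (f t)) with (f2 t) in *.
  destruct (slit_pos _ _ Hx) as [N [P [E Q]]].
  split.
  - change (is_derive (fun u : R => ln (f1 u ^ 2 + f2 u ^ 2) / 2) t
      (fst ((p, q) / (f1 t, f2 t))%C)).
    auto_derive.
    { repeat split; try (eexists; eassumption); simpl in N; lra. }
    rewrite (is_derive_unique _ _ _ A), (is_derive_unique _ _ _ B).
    simpl; field; nra.
  - change (is_derive (fun u : R => 2 * atan (f2 u / (sqrt (f1 u ^ 2 + f2 u ^ 2) + f1 u))) t
      (snd ((p, q) / (f1 t, f2 t))%C)).
    auto_derive.
    { repeat split; try (eexists; eassumption); simpl in *; lra. }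
    rewrite (is_derive_unique _ _ _ A), (is_derive_unique _ _ _ B).
    simpl in E, P, Q, N; simpl; rewrite ?Rmult_1_r in *.
    set (r := sqrt (f1 t * f1 t + f2 t * f2 t)) in *.
    set (u := f1 t) in *; set (v := f2 t) in *; clearbody r u v.
    assert (T : 1 + v * / (r + u) * (v * / (r + u)) = 2 * r / (r + u)).
    { apply (Rmult_eq_reg_r ((r + u) ^ 2)); [|nra].
      field_simplify; nra. }
    rewrite <- E.
    unfold Rdiv in *.
    rewrite T.
    apply (Rmult_eq_reg_r (r ^ 2 * (r + u))); [|nra].
    field_simplify; try (repeat split; nra).
    replace (v ^ 2) with (r * r - u * u) by nra; field.
Qed.

(** The logarithm with its cut along the ray [- i tau], for [tau = 1] or [-1]. *)
Definition slog (tau : R) (z : C) : C :=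
  (Clog (- Ci * RtoC tau * z) + Ci * RtoC (tau * (PI / 2)))%C.

(** Complement of the closed ray from 0 through [- i tau], the cut of [slog tau]. *)
Definition tslit (tau : R) (z : C) : Prop := 0 < tau * snd z \/ fst z <> 0.

Definition is_sign (tau : R) : Prop := tau = 1 \/ tau = -1.

Lemma is_sign_sq (tau : R) : is_sign tau -> tau * tau = 1.
Proof. intros [-> | ->]; ring. Qed.

Lemma is_sign_neq_0 (tau : R) : is_sign tau -> tau <> 0.
Proof. intros [-> | ->]; lra. Qed.

Lemma tslit_slit (tau : R) (z : C) :
  is_sign tau -> tslit tau z -> slit (- Ci * RtoC tau * z)%C.
Proof.
  destruct z as [x y]; unfold tslit, slit; simpl; intros H [A|A]; [left; nra|right].
  destruct H as [-> | ->]; nra.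
Qed.

Lemma continuous_slog (tau : R) (z : C) : is_sign tau -> tslit tau z ->
  @continuous C_UniformSpace C_UniformSpace (slog tau) z.
Proof.
  intros H A; unfold slog; apply continuous_Cplus; [|apply continuous_const].
  apply (continuous_comp (fun z => - Ci * RtoC tau * z)%C Clog).
  - apply continuous_Cmult; [apply continuous_const | apply continuous_id].
  - now apply continuous_Clog, tslit_slit.
Qed.

Lemma is_derive_slog (tau : R) (f : R -> C) (t : R) (l : C) :
  is_sign tau -> tslit tau (f t) -> cderiv f t l ->
  cderiv (fun u => slog tau (f u)) t (l / f t)%C.
Proof.
  intros H A D; unfold slog.
  assert (S := tslit_slit _ _ H A).
  replace (l / f t)%C with ((0 * f t + - Ci * RtoC tau * l) / (- Ci * RtoC tau * f t) + 0)%C.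
  - apply is_derive_Cplus; [|apply is_derive_C_const].
    apply (is_derive_Clog (fun u => - Ci * RtoC tau * f u)%C); auto.
    apply is_derive_Cmult; auto; apply is_derive_C_const.
  - apply slit_neq_0 in S; field; repeat split; intros E; apply S; rewrite E; ring.
Qed.

(** With [t = x / (r + y)], the identity [(r + y) (r - y) = x^2] turns the two arctangents into
    those of [- t] and [1 / t]. Since [atan t + atan (1 / t)] is [pi / 2] with the sign of [t], the
    branches agree on the right half-plane and jump on the left one. *)
Lemma slog_diff (z : C) : fst z <> 0 ->
  (slog 1 z - slog (-1) z)%C =
  (if Rlt_dec (fst z) 0 then RtoC (2 * PI) * Ci else 0)%C.
Proof.
  destruct z as [x y]; cbv beta iota delta [fst snd]; intros H.
  assert (N : 0 < x ^ 2 + y ^ 2) by nra.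
  assert (E := pow2_sqrt _ (Rlt_le _ _ N)).
  assert (P := sqrt_lt_R0 _ N).
  assert (K : forall tau, is_sign tau -> slog tau (x, y) =
    (ln (x ^ 2 + y ^ 2) / 2,
     2 * atan (- tau * x / (sqrt (x ^ 2 + y ^ 2) + tau * y)) + tau * (PI / 2))).
  { intros tau Ht; unfold slog.
    replace (- Ci * RtoC tau * (x, y))%C with (tau * y, - tau * x : R).
    2:{ unfold Ci, Cmult, Copp, RtoC; simpl; f_equal; ring. }
    unfold Clog; cbv beta iota delta [fst snd].
    replace ((tau * y) ^ 2 + (- tau * x) ^ 2) with (x ^ 2 + y ^ 2).
    2:{ destruct Ht as [-> | ->]; ring. }
    unfold Ci, Cmult, Cplus, RtoC; simpl; f_equal; ring. }
  rewrite (K 1), (K (-1)) by (unfold is_sign; auto); clear K.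
  set (r := sqrt (x ^ 2 + y ^ 2)) in *.
  set (t := x / (r + y)).
  assert (R1 : 0 < r + y) by nra.
  assert (R2 : 0 < r - y) by nra.
  replace (- (1) * x / (r + 1 * y)) with (- t) by (unfold t; field; lra).
  assert (T : - -1 * x / (r + -1 * y) = / t).
  { unfold t; field_simplify; try (repeat split; lra).
    apply (Rmult_eq_reg_r ((r - y) * x)); [field_simplify; nra|nra]. }
  rewrite T, atan_opp.
  destruct (Rlt_dec x 0) as [L|L].
  - assert (0 < - t).
    { unfold t; replace (- (x / (r + y))) with (- x / (r + y)) by (field; lra).
      apply Rdiv_lt_0_compat; lra. }
    assert (A := atan_inv (- t) ltac:(lra)).
    rewrite atan_opp in A; rewrite Rinv_opp, atan_opp in A.
    unfold Ci, Cmult, Cminus, Cplus, Copp, RtoC; simpl; f_equal; lra.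
  - assert (0 < t) by (unfold t; apply Rdiv_lt_0_compat; lra).
    rewrite atan_inv by lra.
    unfold Cminus, Cplus, Copp, RtoC; simpl; f_equal; lra.
Qed.

(** * Polynomial and rational functions *)

Lemma continuous_neq_0 (f : C -> C) (a : C) :
  @continuous C_UniformSpace C_UniformSpace f a -> f a <> 0%C ->
  exists r : R, 0 < r /\ forall x : C, Cmod (x - a)%C < r -> f x <> 0%C.
Proof.
  intros Hf Ha.
  assert (L : @locally C_UniformSpace (f a) (fun z : C => z <> 0%C)).
  { assert (N := Rsqr_Cmod_neq_0 _ Ha); destruct (f a) as [u v]; simpl in N.
    destruct (Req_dec u 0) as [Hu|Hu].
    - assert (Hv : 0 < Rabs v) by (apply Rabs_pos_lt; intros ->; nra).
      exists (mkposreal _ Hv); intros z [_ Hz] ->.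
      change (Rabs (0 - v) < Rabs v) in Hz.
      rewrite Rminus_0_l, Rabs_Ropp in Hz; lra.
    - assert (Hu' : 0 < Rabs u) by (now apply Rabs_pos_lt).
      exists (mkposreal _ Hu'); intros z [Hz _] ->.
      change (Rabs (0 - u) < Rabs u) in Hz.
      rewrite Rminus_0_l, Rabs_Ropp in Hz; lra. }
  destruct (Hf _ L) as [e He].
  exists e; split; [apply cond_pos|]; intros x Hx; apply He.
  assert (M := Rmax_Cmod (x - a)%C).
  split; eapply Rle_lt_trans; try exact Hx; eapply Rle_trans; try exact M.
  - apply Rmax_l.
  - apply Rmax_r.
Qed.

(** Polynomial functions of degree at most [n] in Horner form: closure properties and division by
    [x - a] become inductions on [n] without manipulation of coefficients. *)
Fixpoint polyfun (n : nat) (f : C -> C) : Prop :=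
  match n with
  | O => exists c : C, forall x, f x = c
  | S n => exists (c : C) (g : C -> C), polyfun n g /\ forall x, f x = (c + x * g x)%C
  end.

Lemma polyfun_ext n f g : (forall x, f x = g x) -> polyfun n f -> polyfun n g.
Proof.
  intros H; destruct n as [|n]; simpl.
  - intros [c Hc]; exists c; intros x; now rewrite <- H.
  - intros [c [h [Hh Hc]]]; exists c, h; split; auto; intros x; now rewrite <- H.
Qed.

Lemma polyfun_const n (c : C) : polyfun n (fun _ => c).
Proof.
  revert c; induction n as [|n IH]; intros c; simpl; [now exists c|].
  exists c, (fun _ => RtoC 0); split; [apply IH|]; intros x; ring.
Qed.

Lemma polyfun_S n f : polyfun n f -> polyfun (S n) f.
Proof.
  revert f; induction n as [|n IH]; intros f.
  - intros [c Hc]; exists c, (fun _ => RtoC 0); split; [apply polyfun_const|].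
    intros x; rewrite Hc; ring.
  - intros [c [g [Hg Hc]]]; exists c, g; split; auto.
Qed.

Lemma polyfun_le n m f : (n <= m)%nat -> polyfun n f -> polyfun m f.
Proof. induction 1; auto; intros; apply polyfun_S; auto. Qed.

Lemma polyfun_plus n f g :
  polyfun n f -> polyfun n g -> polyfun n (fun x => f x + g x)%C.
Proof.
  revert f g; induction n as [|n IH]; intros f g.
  - intros [c Hc] [d Hd]; exists (c + d)%C; intros x; now rewrite Hc, Hd.
  - intros [c [h [Hh Hc]]] [d [k [Hk Hd]]]; exists (c + d)%C, (fun x => h x + k x)%C.
    split; auto; intros x; rewrite Hc, Hd; ring.
Qed.

Lemma polyfun_scal n (c : C) f : polyfun n f -> polyfun n (fun x => c * f x)%C.
Proof.
  revert f; induction n as [|n IH]; intros f.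
  - intros [d Hd]; exists (c * d)%C; intros x; now rewrite Hd.
  - intros [d [k [Hk Hd]]]; exists (c * d)%C, (fun x => c * k x)%C.
    split; auto; intros x; rewrite Hd; ring.
Qed.

Lemma polyfun_mult n m f g :
  polyfun n f -> polyfun m g -> polyfun (n + m) (fun x => f x * g x)%C.
Proof.
  revert f; induction n as [|n IH]; intros f.
  - intros [c Hc] Hg; apply (polyfun_ext _ (fun x => c * g x)%C).
    + intros x; now rewrite Hc.
    + now apply polyfun_scal.
  - intros [c [h [Hh Hc]]] Hg.
    apply (polyfun_ext _ (fun x => c * g x + x * (h x * g x))%C).
    + intros x; rewrite Hc; ring.
    + apply polyfun_plus.
      * apply polyfun_scal, (polyfun_le m); auto; lia.
      * exists 0%C, (fun x => h x * g x)%C; split; [now apply IH|]; intros x; ring.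
Qed.

Lemma polyfun_linear (a b : C) : polyfun 1 (fun x => a * x + b)%C.
Proof. exists b, (fun _ => a); split; [now exists a|]; intros x; ring. Qed.

Lemma polyfun_pow n f k : polyfun n f -> polyfun (k * n) (fun x => f x ^ k)%C.
Proof.
  intros H; induction k as [|k IH]; [now exists 1%C|].
  now apply (polyfun_mult n (k * n)).
Qed.

Lemma polyfun_continuous n f x :
  polyfun n f -> @continuous C_UniformSpace C_UniformSpace f x.
Proof.
  revert f; induction n as [|n IH]; intros f.
  - intros [c Hc]; apply (continuous_ext (fun _ => c)); [now intros|].
    apply continuous_const.
  - intros [c [g [Hg Hc]]]; apply (continuous_ext (fun x => c + x * g x)%C); [now intros|].
    apply continuous_Cplus; [apply continuous_const|].
    apply continuous_Cmult; [apply continuous_id | now apply IH].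
Qed.

Lemma polynomial_S n p x :
  polynomial (S n) p x = (p O + x * polynomial n (fun k => p (S k)) x)%C.
Proof.
  unfold polynomial; induction n as [|n IH].
  - rewrite sum_Sn, !sum_O; change (@plus C_AbelianMonoid) with Cplus; simpl; ring.
  - rewrite sum_Sn, IH, sum_Sn; change (@plus C_AbelianMonoid) with Cplus; simpl; ring.
Qed.

Lemma polyfun_polynomial n p : polyfun n (polynomial n p).
Proof.
  revert p; induction n as [|n IH]; intros p.
  - exists (p O); intros x; unfold polynomial; rewrite sum_O; simpl; ring.
  - exists (p O), (polynomial n (fun k => p (S k))); split; auto.
    intros x; apply polynomial_S.
Qed.

Lemma polyfun_coeffs n f : polyfun n f -> exists p, forall x, f x = polynomial n p x.
Proof.
  revert f; induction n as [|n IH]; intros f.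
  - intros [c Hc]; exists (fun _ => c); intros x; rewrite Hc.
    unfold polynomial; rewrite sum_O; simpl; ring.
  - intros [c [g [Hg Hc]]]; destruct (IH g Hg) as [p Hp].
    exists (fun k => match k with O => c | S k => p k end); intros x.
    now rewrite polynomial_S, Hc, Hp.
Qed.

Lemma polyfun_factor n f a : polyfun (S n) f ->
  exists g, polyfun n g /\ forall x, f x = (f a + (x - a) * g x)%C.
Proof.
  revert f; induction n as [|n IH]; intros f [c [h [Hh Hc]]].
  - destruct Hh as [d Hd]; exists (fun _ => d); split; [now exists d|].
    intros x; rewrite !Hc, !Hd; ring.
  - destruct (IH h Hh) as [k [Hk Ek]]; exists (fun x => h a + x * k x)%C; split.
    + exists (h a), k; now split.
    + intros x; rewrite !Hc, (Ek x); ring.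
Qed.

(** If [f a] is nonzero, continuity suffices. At a root, [x - a] factors out, the cofactor is still
    not identically zero, and its degree has dropped. *)
Lemma polyfun_isolated n f (a : C) :
  polyfun n f -> (exists x, f x <> 0%C) ->
  exists r : R, 0 < r /\ forall x, 0 < Cmod (x - a)%C < r -> f x <> 0%C.
Proof.
  revert f; induction n as [|n IH]; intros f Hf [x0 Hx0].
  - destruct Hf as [c Hc]; exists 1; split; [lra|]; intros x _; now rewrite Hc, <- (Hc x0).
  - destruct (classic (f a = 0%C)) as [Ha|Ha].
    + destruct (polyfun_factor n f a Hf) as [g [Hg E]].
      destruct (IH g Hg) as [r [Hr Hn]].
      { exists x0; intros G; apply Hx0; rewrite E, Ha, G; ring. }
      exists r; split; auto; intros x Hx; rewrite E, Ha, Cplus_0_l.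
      apply Cmult_neq_0; auto.
      apply Cmod_gt_0; lra.
    + destruct (continuous_neq_0 f a) as [r [Hr Hn]]; auto.
      { eapply polyfun_continuous; eassumption. }
      exists r; split; auto; intros x Hx; apply Hn; lra.
Qed.

Lemma polynomial_neq_0 n (d : nat -> C) :
  (exists k, (k <= n)%nat /\ d k <> 0%C) -> exists x, polynomial n d x <> 0%C.
Proof.
  intros [k [Hk Hd]]; apply NNPP; intros N; apply Hd; clear Hd.
  assert (Z : forall x, polynomial n d x = 0%C).
  { intros x; apply NNPP; intros H; apply N; now exists x. }
  clear N; revert d k Hk Z; induction n as [|n IH]; intros d k Hk Z.
  - specialize (Z 0%C); unfold polynomial in Z; rewrite sum_O in Z.
    replace k with O by lia.
    transitivity (d O * Cpow 0 0)%C; [simpl; ring|exact Z].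
  - assert (D0 : d O = 0%C) by (transitivity (polynomial (S n) d 0%C); auto; rewrite polynomial_S; ring).
    destruct k as [|k]; auto.
    apply (IH (fun k => d (S k))); [lia|].
    (* Since [x] times the shifted polynomial is zero, the latter vanishes for [x <> 0]; isolation
       of zeros then rules out that it is nonzero anywhere. *)
    apply NNPP; intros N; apply not_all_ex_not in N.
    destruct (polyfun_isolated n _ 0%C (polyfun_polynomial n _) N) as [r [Hr Hn]].
    apply (Hn (RtoC (r / 2))).
    + replace (RtoC (r / 2) - 0)%C with (RtoC (r / 2)) by ring.
      rewrite Cmod_R, Rabs_right; lra.
    + specialize (Z (RtoC (r / 2))); rewrite polynomial_S, D0, Cplus_0_l in Z.
      apply NNPP; intros H; revert Z; apply Cmult_neq_0; auto.
      intros Z; injection Z; lra.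
Qed.

(** The cross-multiplied difference is a polynomial which vanishes at points arbitrarily close to
    [b], hence everywhere. Dividing back requires nonzero denominators, which a small punctured disc
    around [a] provides; at a zero of a denominator the values depend on the convention for division
    by 0. *)
Lemma rational_identity (Q Q' : C -> C) (b : C) (r : R) :
  is_rational Q -> is_rational Q' -> 0 < r ->
  (forall x, Cmod (x - b)%C < r -> Q x = Q' x) ->
  forall a : C, exists e : R, 0 < e /\ forall x, 0 < Cmod (x - a)%C < e -> Q x = Q' x.
Proof.
  intros [m [n [P [D [HD E]]]]] [m' [n' [P' [D' [HD' E']]]]] Hr Hb a.
  assert (I := fun c => polyfun_isolated n _ c (polyfun_polynomial n D) (polynomial_neq_0 n D HD)).
  assert (I' := fun c => polyfun_isolated n' _ c (polyfun_polynomial n' D') (polynomial_neq_0 n' D' HD')).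
  assert (Z : forall x, (polynomial m P x * polynomial n' D' x
                + - (1) * (polynomial m' P' x * polynomial n D x) = 0)%C).
  { intros x; apply NNPP; intros N.
    set (k := (m + n' + (m' + n))%nat).
    destruct (polyfun_isolated k (fun x => polynomial m P x * polynomial n' D' x
                + - (1) * (polynomial m' P' x * polynomial n D x))%C b) as [s [Hs Hn]].
    - apply polyfun_plus.
      + apply (polyfun_le (m + n')); [unfold k; lia|].
        apply polyfun_mult; apply polyfun_polynomial.
      + apply polyfun_scal, (polyfun_le (m' + n)); [unfold k; lia|].
        apply polyfun_mult; apply polyfun_polynomial.
    - now exists x.
    - destruct (I b) as [u [Hu Nu]], (I' b) as [v [Hv Nv]].
      (* At [b + w] the two functions agree, both denominators are nonzero, and so would be the
         difference: a contradiction. *)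
      set (w := Rmin (Rmin r s) (Rmin u v) / 2).
      assert (W : 0 < w /\ w < r /\ w < s /\ w < u /\ w < v).
      { unfold w; assert (0 < Rmin (Rmin r s) (Rmin u v)) by (repeat apply Rmin_pos; auto).
        assert (A1 := Rmin_l (Rmin r s) (Rmin u v)); assert (A2 := Rmin_r (Rmin r s) (Rmin u v)).
        assert (A3 := Rmin_l r s); assert (A4 := Rmin_r r s).
        assert (A5 := Rmin_l u v); assert (A6 := Rmin_r u v); lra. }
      assert (M : Cmod (b + RtoC w - b)%C = w).
      { replace (b + RtoC w - b)%C with (RtoC w) by ring; rewrite Cmod_R, Rabs_right; lra. }
      apply (Hn (b + RtoC w)%C); [rewrite M; lra|].
      assert (B := Hb (b + RtoC w)%C ltac:(rewrite M; lra)).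
      rewrite E, E' in B.
      assert (B1 := Nu (b + RtoC w)%C ltac:(rewrite M; lra)).
      assert (B2 := Nv (b + RtoC w)%C ltac:(rewrite M; lra)).
      set (X := (b + RtoC w)%C) in *.
      replace (polynomial m P X) with (polynomial m P X / polynomial n D X * polynomial n D X)%C
        by (field; auto).
      rewrite B; field; auto. }
  destruct (I a) as [u [Hu Nu]], (I' a) as [v [Hv Nv]].
  exists (Rmin u v); split; [now apply Rmin_pos|]; intros x Hx.
  assert (A5 := Rmin_l u v); assert (A6 := Rmin_r u v).
  assert (B1 := Nu x ltac:(lra)); assert (B2 := Nv x ltac:(lra)).
  rewrite E, E'; specialize (Z x).
  assert (F : (polynomial m P x * polynomial n' D' x)%C =
    (polynomial m' P' x * polynomial n D x)%C).
  { rewrite <- (Cplus_0_r (polynomial m' P' x * polynomial n D x)), <- Z; ring. }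
  transitivity ((polynomial m P x * polynomial n' D' x) /
    (polynomial n D x * polynomial n' D' x))%C; [field; auto|].
  rewrite F; field; auto.
Qed.

Lemma polynomial_zero n (d : nat -> C) x :
  (forall k, (k <= n)%nat -> d k = 0%C) -> polynomial n d x = 0%C.
Proof.
  revert d; induction n as [|n IH]; intros d H.
  - unfold polynomial; rewrite sum_O, H by lia; apply Cmult_0_l.
  - rewrite polynomial_S, H, IH by (intros; try apply H; lia); ring.
Qed.

(** * Integer powers and primitives *)

Definition zpow (z : C) (k : Z) : C :=
  match k with
  | Z0 => 1
  | Zpos n => z ^ Pos.to_nat n
  | Zneg n => / z ^ Pos.to_nat n
  end%C.

Lemma zpow_nat (z : C) (n : nat) : zpow z (Z.of_nat n) = (z ^ n)%C.
Proof. destruct n; auto; simpl; now rewrite SuccNat2Pos.id_succ. Qed.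

Lemma zpow_opp (z : C) (n : nat) : zpow z (- Z.of_nat n) = (/ z ^ n)%C.
Proof.
  destruct n; simpl; [|now rewrite SuccNat2Pos.id_succ].
  field; intros E; injection E; lra.
Qed.

Lemma Z_nat_cases (k : Z) : exists n : nat, k = Z.of_nat n \/ k = (- Z.of_nat (S n))%Z.
Proof.
  destruct (Z_le_dec 0 k).
  - exists (Z.to_nat k); left; lia.
  - exists (Z.to_nat (- k - 1)); right; lia.
Qed.

Lemma zpow_succ (z : C) (k : Z) : z <> 0%C -> zpow z (k + 1) = (z * zpow z k)%C.
Proof.
  intros Hz; destruct (Z_nat_cases k) as [n [-> | ->]].
  - replace (Z.of_nat n + 1)%Z with (Z.of_nat (S n)) by lia.
    now rewrite !zpow_nat.
  - replace (- Z.of_nat (S n) + 1)%Z with (- Z.of_nat n)%Z by lia.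
    rewrite !zpow_opp; simpl; assert (H := Cpow_nz z n Hz); field; auto.
Qed.

Lemma Cexp_zpow (k : Z) (z : C) : Cexp (RtoC (IZR k) * z)%C = zpow (Cexp z) k.
Proof.
  assert (N : forall n, Cexp (RtoC (INR n) * z)%C = (Cexp z ^ n)%C).
  { induction n as [|n IH]; [simpl; rewrite Cmult_0_l; apply Cexp_0|].
    rewrite S_INR, RtoC_plus, Cmult_plus_distr_r, Cexp_add, IH, Cmult_1_l; simpl; ring. }
  destruct (Z_nat_cases k) as [n [-> | ->]].
  - now rewrite zpow_nat, <- INR_IZR_INZ.
  - rewrite zpow_opp, opp_IZR, <- INR_IZR_INZ, <- N, <- Cexp_opp.
    apply (f_equal Cexp); rewrite RtoC_opp; ring.
Qed.

Lemma is_derive_Cpow (f : R -> C) t l (n : nat) : cderiv f t l ->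
  cderiv (fun u => f u ^ S n)%C t (RtoC (INR (S n)) * f t ^ n * l)%C.
Proof.
  intros H; induction n as [|n IH].
  - apply (cderiv_ext f); [intros u; symmetry; apply Cmult_1_r|].
    replace (RtoC (INR 1) * f t ^ 0 * l)%C with l by (simpl; ring); exact H.
  - replace (RtoC (INR (S (S n))) * f t ^ S n * l)%C with
      (l * f t ^ S n + f t * (RtoC (INR (S n)) * f t ^ n * l))%C.
    + apply (is_derive_Cmult f (fun u => f u ^ S n)%C); auto.
    + rewrite (S_INR (S n)), RtoC_plus; simpl Cpow; ring.
Qed.

Lemma is_derive_zpow (f : R -> C) t l (k : Z) : f t <> 0%C -> cderiv f t l ->
  cderiv (fun u => zpow (f u) (k + 1)) t (RtoC (IZR (k + 1)) * zpow (f t) k * l)%C.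
Proof.
  intros Hz H; destruct (Z_nat_cases k) as [n [-> | ->]].
  - replace (Z.of_nat n + 1)%Z with (Z.of_nat (S n)) by lia.
    rewrite <- INR_IZR_INZ, zpow_nat.
    apply (cderiv_ext (fun u => f u ^ S n)%C); [intros; now rewrite zpow_nat|].
    now apply is_derive_Cpow.
  - replace (- Z.of_nat (S n) + 1)%Z with (- Z.of_nat n)%Z by lia.
    rewrite opp_IZR, <- INR_IZR_INZ, zpow_opp.
    apply (cderiv_ext (fun u => / f u ^ n)%C); [intros; now rewrite zpow_opp|].
    destruct n as [|n].
    (* The case [k = -1]: the power is constant and the factor [k + 1] is 0. *)
    + apply (cderiv_ext (fun _ => / (RtoC 1))%C); [reflexivity|].
      replace (RtoC (- INR 0) * / f t ^ 1 * l)%C with (RtoC 0).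
      * apply is_derive_C_const.
      * simpl; rewrite Ropp_0; ring.
    + assert (N := Cpow_nz (f t) n Hz).
      replace (RtoC (- INR (S n)) * / f t ^ S (S n) * l)%C with
       (- (RtoC (INR (S n)) * f t ^ n * l) / (f t ^ S n * f t ^ S n))%C.
      * apply is_derive_Cinv; [now apply Cpow_nz|]. now apply is_derive_Cpow.
      * rewrite RtoC_opp; simpl; field; split; auto.
Qed.

Lemma continuous_zpow {U : UniformSpace} (f : U -> C) (k : Z) (x : U) :
  f x <> 0%C -> @continuous U C_UniformSpace f x ->
  @continuous U C_UniformSpace (fun t => zpow (f t) k) x.
Proof.
  intros Hz H; destruct (Z_nat_cases k) as [n [-> | ->]].
  - apply (continuous_ext (fun t => f t ^ n)%C); [intros; now rewrite zpow_nat|].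
    now apply continuous_Cpow.
  - apply (continuous_ext (fun t => / f t ^ S n)%C); [intros; now rewrite zpow_opp|].
    apply continuous_Cinv; [now apply continuous_Cpow | now apply Cpow_nz].
Qed.

(** [F] is a primitive of [q] on [V], tested along differentiable curves. *)
Definition primitive_on (V : C -> Prop) (F q : C -> C) : Prop :=
  forall x, V x -> @continuous C_UniformSpace C_UniformSpace F x /\
    forall (gamma : R -> C) (t : R) (l : C), gamma t = x -> cderiv gamma t l ->
      cderiv (fun u => F (gamma u)) t (q x * l)%C.

Lemma primitive_plus V F G f g : primitive_on V F f -> primitive_on V G g ->
  primitive_on V (fun x => F x + G x)%C (fun x => f x + g x)%C.
Proof.
  intros HF HG x Hx; destruct (HF x Hx) as [A B], (HG x Hx) as [A' B']; split.
  - now apply continuous_Cplus.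
  - intros gamma t l Et Hl; rewrite Cmult_plus_distr_r.
    apply is_derive_Cplus; auto.
Qed.

Lemma primitive_scal V F f (c : C) : primitive_on V F f ->
  primitive_on V (fun x => c * F x)%C (fun x => c * f x)%C.
Proof.
  intros HF x Hx; destruct (HF x Hx) as [A B]; split.
  - apply continuous_Cmult; [apply continuous_const | auto].
  - intros gamma t l Et Hl.
    replace (c * f x * l)%C with (0 * F (gamma t) + c * (f x * l))%C by ring.
    apply (is_derive_Cmult (fun _ => c)); auto; apply is_derive_C_const.
Qed.

Lemma primitive_ext V F f g : (forall x, V x -> f x = g x) ->
  primitive_on V F f -> primitive_on V F g.
Proof. intros E HF x Hx; rewrite <- E by auto; now apply HF. Qed.

Lemma primitive_sub (V V' : C -> Prop) F f : (forall x, V' x -> V x) ->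
  primitive_on V F f -> primitive_on V' F f.
Proof. intros E HF x Hx; now apply HF, E. Qed.

Lemma is_derive_sub_const (f : R -> C) t l (e : C) :
  cderiv f t l -> cderiv (fun u => f u - e)%C t l.
Proof.
  intros H; replace l with (l + 0)%C by ring.
  apply (is_derive_Cplus f (fun _ => - e)%C); auto; apply is_derive_C_const.
Qed.

Lemma primitive_zpow (V : C -> Prop) (e : C) (k : Z) : k <> (-1)%Z ->
  (forall x, V x -> x <> e) ->
  primitive_on V (fun x => / RtoC (IZR (k + 1)) * zpow (x - e) (k + 1))%C
    (fun x => zpow (x - e) k)%C.
Proof.
  intros Hk HV.
  apply (primitive_ext _ _ (fun x => / RtoC (IZR (k + 1)) *
    (RtoC (IZR (k + 1)) * zpow (x - e) k))%C).
  { intros x _; field; intros E; injection E; intros E'; apply Hk.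
    apply eq_IZR in E'; lia. }
  apply (primitive_scal V (fun x => zpow (x - e) (k + 1))
    (fun x => RtoC (IZR (k + 1)) * zpow (x - e) k)%C).
  intros x Hx.
  assert (Hz : (x - e)%C <> 0%C).
  { apply Cminus_neq_0; auto. }
  split.
  - apply (continuous_zpow (fun x => x - e)%C); auto.
    apply continuous_Cminus; [apply continuous_id | apply continuous_const].
  - intros gamma t l <- Hl.
    apply (is_derive_zpow (fun u => gamma u - e)%C); auto.
    now apply is_derive_sub_const.
Qed.

(** * Partial fractions *)

(** The constant [d] is the obstruction to a single-valued primitive; [is_residue_primitive]
    recognises it as a residue when [V] contains a punctured neighbourhood of [p]. *)
Definition log_primitive (V : C -> Prop) (p : C) (f : C -> C) : Prop :=
  exists (d : C) (G : C -> C), primitive_on V G (fun x => f x - d / (x - p))%C.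

Section PartialFractions.
Variables (V : C -> Prop) (p e : C).
Hypothesis Hp : forall x, V x -> x <> p.
Hypothesis He : forall x, V x -> x <> e.
Hypothesis Hpe : p <> e.
(** This separates the roles of the poles: [V] may surround [p], while [e] lies outside the disc,
    where its logarithm is single valued. *)
Hypothesis Hlog : exists L, primitive_on V L (fun x => / (x - e))%C.

Local Notation PP := (log_primitive V p).

Lemma log_primitive_ext f g : (forall x, V x -> f x = g x) -> PP f -> PP g.
Proof.
  intros E [d [G HG]]; exists d, G; revert HG; apply primitive_ext.
  intros x Hx; now rewrite E.
Qed.

Lemma log_primitive_plus f g : PP f -> PP g -> PP (fun x => f x + g x)%C.
Proof.
  intros [d [F HF]] [c [G HG]]; exists (d + c)%C, (fun x => F x + G x)%C.
  generalize (primitive_plus _ _ _ _ _ HF HG); apply primitive_ext.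
  intros x Hx; field; apply Cminus_neq_0; auto.
Qed.

Lemma log_primitive_scal (c : C) f : PP f -> PP (fun x => c * f x)%C.
Proof.
  intros [d [F HF]]; exists (c * d)%C, (fun x => c * F x)%C.
  generalize (primitive_scal _ _ _ c HF); apply primitive_ext.
  intros x Hx; field; apply Cminus_neq_0; auto.
Qed.

Lemma log_primitive_of_primitive F f : primitive_on V F f -> PP f.
Proof.
  intros H; exists 0%C, F; revert H; apply primitive_ext.
  intros x Hx; field; apply Cminus_neq_0; auto.
Qed.

Lemma zpow_m1 (z : C) : zpow z (-1) = (/ z)%C.
Proof. simpl; now rewrite Cmult_1_r. Qed.

Lemma log_primitive_zpow_p k : PP (fun x => zpow (x - p) k).
Proof.
  destruct (Z.eq_dec k (-1)) as [->|Hk].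
  - exists 1%C, (fun _ => RtoC 0).
    intros x Hx; split; [apply continuous_const|].
    intros gamma t l Et Hl; rewrite zpow_m1.
    replace ((/ (x - p) - 1 / (x - p)) * l)%C with (RtoC 0).
    + apply is_derive_C_const.
    + field; apply Cminus_neq_0; auto.
  - eapply log_primitive_of_primitive, primitive_zpow; auto.
Qed.

Lemma log_primitive_zpow_e k : PP (fun x => zpow (x - e) k).
Proof.
  destruct (Z.eq_dec k (-1)) as [->|Hk].
  - destruct Hlog as [L HL]; apply (log_primitive_of_primitive L).
    revert HL; apply primitive_ext; intros x _; now rewrite zpow_m1.
  - eapply log_primitive_of_primitive, primitive_zpow; auto.
Qed.

Definition bimonomial (i j : Z) (x : C) : C := (zpow (x - p) i * zpow (x - e) j)%C.

(** Raises either exponent of a bimonomial by one, hence drives the induction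
    down to pure powers. *)
Lemma bimonomial_exchange i j x : V x ->
  (bimonomial (i + 1) j x - bimonomial i (j + 1) x = (e - p) * bimonomial i j x)%C.
Proof.
  intros Hx; unfold bimonomial.
  rewrite !zpow_succ by (apply Cminus_neq_0; auto); ring.
Qed.

(** Writing one factor [x - e] as [(x - p) + (p - e)] lowers its exponent; [i] stays arbitrary in
    the induction because it rises in the first term. *)
Lemma log_primitive_bimonomial_nat n : forall i, PP (bimonomial i (Z.of_nat n)).
Proof.
  induction n as [|n IH]; intros i.
  - apply (log_primitive_ext (fun x => zpow (x - p) i)).
    + intros x _; unfold bimonomial; simpl; ring.
    + apply log_primitive_zpow_p.
  - apply (log_primitive_ext (fun x => bimonomial (i + 1) (Z.of_nat n) x +
      (p - e) * bimonomial i (Z.of_nat n) x)%C).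
    + intros x Hx; replace (Z.of_nat (S n)) with (Z.of_nat n + 1)%Z by lia.
      assert (E := bimonomial_exchange i (Z.of_nat n) x Hx).
      replace (bimonomial i (Z.of_nat n + 1) x) with (bimonomial (i + 1) (Z.of_nat n) x -
        (bimonomial (i + 1) (Z.of_nat n) x - bimonomial i (Z.of_nat n + 1) x))%C by ring.
      rewrite E; ring.
    + apply log_primitive_plus; auto; now apply log_primitive_scal.
Qed.

(** Dividing the exchange relation by [e - p] expresses a bimonomial through two others, each with
    total pole order lower by one. *)
Lemma log_primitive_bimonomial_opp a : forall b,
  PP (bimonomial (- Z.of_nat a) (- Z.of_nat b)).
Proof.
  induction a as [|a IHa].
  - intros b; apply (log_primitive_ext (fun x => zpow (x - e) (- Z.of_nat b))).
    + intros x _; unfold bimonomial; simpl; ring.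
    + apply log_primitive_zpow_e.
  - induction b as [|b IHb].
    + apply (log_primitive_bimonomial_nat 0).
    + apply (log_primitive_ext (fun x => / (e - p) *
        (bimonomial (- Z.of_nat a) (- Z.of_nat (S b)) x +
         - (1) * bimonomial (- Z.of_nat (S a)) (- Z.of_nat b) x))%C).
      * intros x Hx.
        assert (E := bimonomial_exchange (- Z.of_nat (S a)) (- Z.of_nat (S b)) x Hx).
        replace (- Z.of_nat (S a) + 1)%Z with (- Z.of_nat a)%Z in E by lia.
        replace (- Z.of_nat (S b) + 1)%Z with (- Z.of_nat b)%Z in E by lia.
        transitivity (/ (e - p) * ((e - p) *
          bimonomial (- Z.of_nat (S a)) (- Z.of_nat (S b)) x))%C.
        -- rewrite <- E; ring.
        -- field; apply Cminus_neq_0; auto.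
      * apply log_primitive_scal, log_primitive_plus; auto.
        now apply log_primitive_scal.
Qed.

(** In [w = c + x g], the factor [x = (x - e) + e] is absorbed into the exponent [j], which is
    therefore quantified in the induction and may become nonnegative. *)
Lemma log_primitive_rational n w a : polyfun n w -> forall j,
  PP (fun x => w x * bimonomial (- Z.of_nat a) j x)%C.
Proof.
  revert w; induction n as [|n IH]; intros w Hw j.
  - destruct Hw as [c Hc].
    apply (log_primitive_ext (fun x => c * bimonomial (- Z.of_nat a) j x)%C).
    { intros x _; now rewrite Hc. }
    apply log_primitive_scal.
    destruct (Z_nat_cases j) as [b [-> | ->]].
    + apply log_primitive_bimonomial_nat.
    + apply log_primitive_bimonomial_opp.
  - destruct Hw as [c [g [Hg Hc]]].
    apply (log_primitive_ext (fun x => c * bimonomial (- Z.of_nat a) j x +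
      (g x * bimonomial (- Z.of_nat a) (j + 1) x +
       e * (g x * bimonomial (- Z.of_nat a) j x)))%C).
    { intros x Hx; rewrite Hc; unfold bimonomial; rewrite zpow_succ; [ring|].
      apply Cminus_neq_0; auto. }
    apply log_primitive_plus; [|apply log_primitive_plus].
    + apply log_primitive_scal.
      destruct (Z_nat_cases j) as [b [-> | ->]].
      * apply log_primitive_bimonomial_nat.
      * apply log_primitive_bimonomial_opp.
    + now apply IH.
    + now apply log_primitive_scal, IH.
Qed.

End PartialFractions.

(** * Path integrals in the half-discs *)

Lemma continuous_along (q : C -> C) (gamma : R -> C) (t : R) (l : C) :
  cderiv gamma t l -> @continuous C_UniformSpace C_UniformSpace q (gamma t) ->
  @continuous R_UniformSpace C_UniformSpace (fun u => q (gamma u)) t.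
Proof.
  intros H Hq; apply (continuous_comp gamma q); auto.
  apply (ex_derive_continuous (V := C_R_NormedModule) gamma); now exists l.
Qed.

Section PathIntegral.
Variables (U V : C -> Prop) (F Q q : C -> C) (a x : C).
Hypothesis HF : primitive_on V F Q.
Hypothesis HQ : forall z, V z -> @continuous C_UniformSpace C_UniformSpace Q z.
Hypothesis HUV : forall z, U z -> V z.
Hypothesis Ha : V a.
Hypothesis Hq : forall z, U z -> Q z = q z.

(** The path starts at a point [a] that may be outside [U], where it is merely continuous. The
    fundamental theorem is applied on [[u, 1]], and continuity of [F] at [a], which lies in the
    larger set [V], allows [u] to tend to 0. *)
Lemma is_path_integral_primitive (gamma dgamma : R -> C) :
  is_path U a x gamma dgamma ->
  is_RInt_gen (V := C_R_NormedModule)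
    (fun t => (q (gamma t) * dgamma t)%C) (at_right 0) (at_point 1) (F x - F a)%C.
Proof.
  intros [G0 [G1 [Gl G]]] P HP.
  assert (L : filterlim (fun u => (F x - F (gamma u))%C) (at_right 0)
    (@locally C_UniformSpace (F x - F a)%C)).
  { apply (filterlim_comp _ _ _ gamma (fun z => (F x - F z)%C) _ (@locally C_UniformSpace a)); auto.
    apply (continuous_Cminus (U := C_UniformSpace) (fun _ => F x) F a).
    - apply continuous_const.
    - now apply HF. }
  apply (Filter_prod _ _ _ (fun u => 0 < u < 1 /\ P (F x - F (gamma u))%C) (fun v => v = 1)).
  - apply filter_and; [|exact (L P HP)].
    exists (mkposreal 1 Rlt_0_1); intros u Hu H0.
    apply Rabs_def2 in Hu; simpl in Hu; unfold minus, plus, opp in Hu; simpl in Hu; lra.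
  - reflexivity.
  - intros u v [Hu HPu] ->; exists (F x - F (gamma u))%C; split; auto; simpl.
    apply (is_RInt_ext (V := C_R_NormedModule) (fun t => (Q (gamma t) * dgamma t)%C)).
    { intros t; rewrite Rmin_left, Rmax_right by lra; intros Ht.
      rewrite Hq; auto; apply G; lra. }
    rewrite <- G1.
    apply (is_RInt_derive (V := C_R_CompleteNormedModule) (fun t => F (gamma t))
      (fun t => (Q (gamma t) * dgamma t)%C)).
    + intros t; rewrite Rmin_left, Rmax_right by lra; intros Ht.
      destruct (G t ltac:(lra)) as [GU [GD _]].
      now apply (HF (gamma t)); auto.
    + intros t; rewrite Rmin_left, Rmax_right by lra; intros Ht.
      destruct (G t ltac:(lra)) as [GU [GD GC]].
      apply (continuous_Cmult (fun t => Q (gamma t)) dgamma); auto.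
      eapply continuous_along; eauto.
Qed.

Lemma path_integral_primitive :
  (exists gamma dgamma, is_path U a x gamma dgamma) ->
  path_integral U q a x = (F x - F a)%C.
Proof.
  intros [gamma [dgamma HG]]; apply (iota_unique (V := C_R_CompleteNormedModule)).
  - intros v [g [dg [Hg Hv]]].
    assert (Hv' := is_path_integral_primitive g dg Hg).
    apply (is_RInt_gen_unique (V := C_R_CompleteNormedModule)) in Hv.
    apply (is_RInt_gen_unique (V := C_R_CompleteNormedModule)) in Hv'.
    now rewrite <- Hv, <- Hv'.
  - exists gamma, dgamma; split; auto; now apply is_path_integral_primitive.
Qed.

End PathIntegral.

(** * Explicit paths from the base point *)

Lemma is_path_components (U : C -> Prop) (f1 f2 d1 d2 : R -> R) :
  (forall t, 0 <= t <= 1 -> is_derive f1 t (d1 t) /\ is_derive f2 t (d2 t) /\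
     continuous d1 t /\ continuous d2 t) ->
  (forall t, 0 < t <= 1 -> U (f1 t, f2 t)) ->
  is_path U (f1 0, f2 0) (f1 1, f2 1) (fun t => (f1 t, f2 t)) (fun t => (d1 t, d2 t)).
Proof.
  intros H HU; split; [reflexivity|]; split; [reflexivity|]; split.
  - destruct (H 0 ltac:(lra)) as [A [B _]].
    apply filterlim_C_pair; [apply at_right_proper_filter|]; simpl; split.
    + apply (filterlim_filter_le_1 (F := locally 0)).
      * apply filter_le_within.
      * apply (ex_derive_continuous f1); now exists (d1 0).
    + apply (filterlim_filter_le_1 (F := locally 0)).
      * apply filter_le_within.
      * apply (ex_derive_continuous f2); now exists (d2 0).
  - intros t Ht; destruct (H t ltac:(lra)) as [A [B [A' B']]].
    split; auto; split.
    + now apply is_derive_C_pair.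
    + now apply continuous_C_pair.
Qed.

Definition half_disc (s rho delta tau : R) (x : C) : Prop :=
  Cmod x < rho /\ - (delta * Rmax 0 (Rabs (Re x) - s)) < tau * Im x.

Lemma Cmod_le_sum (u v : R) : Cmod (u, v) <= Rabs u + Rabs v.
Proof.
  replace (u, v) with (RtoC u + Ci * RtoC v)%C.
  - eapply Rle_trans; [apply Cmod_triangle|].
    rewrite Cmod_mult, !Cmod_R.
    replace (Cmod Ci) with 1; [lra|].
    unfold Cmod, Ci; simpl; replace (0 * (0 * 1) + 1 * (1 * 1)) with 1 by ring.
    symmetry; apply sqrt_1.
  - unfold Ci, RtoC, Cmult, Cplus; simpl; f_equal; ring.
Qed.

Section Paths.
Variables (s rho delta tau alpha : R).
Hypotheses (Hs : 0 < s < rho) (Hd : 0 < delta) (Ht : is_sign tau) (Ha : is_sign alpha).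
Let U := half_disc s rho delta tau.

Lemma is_sign_Rabs (z : R) : is_sign z -> Rabs z = 1.
Proof. intros [-> | ->]; [apply Rabs_R1 | rewrite Rabs_left; lra]. Qed.

Lemma Rabs_sign_ge u : alpha * u <= Rabs u.
Proof.
  destruct Ha as [-> | ->]; unfold Rabs; destruct (Rcase_abs u); lra.
Qed.

(** On the side of the base point the enlargement is a sector with vertex [alpha s], hence
    star-shaped about the start of the path. *)
Lemma straight_path (x : C) : U x -> s < alpha * Re x ->
  exists gamma dgamma, is_path U (RtoC (alpha * s)) x gamma dgamma.
Proof.
  destruct x as [r y]; intros [H1 H2] Hr; simpl in Hr, H2.
  set (f1 := fun t => alpha * s + t * (r - alpha * s)).
  set (f2 := fun t => t * y).
  exists (fun t => (f1 t, f2 t)), (fun _ => (r - alpha * s, y)).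
  replace (RtoC (alpha * s)) with (f1 0, f2 0) by (unfold f1, f2, RtoC; f_equal; ring).
  replace (r, y) with (f1 1, f2 1) by (unfold f1, f2; f_equal; ring).
  apply (is_path_components U f1 f2 (fun _ => r - alpha * s) (fun _ => y)).
  - intros t _; split; [|split; [|split; apply continuous_const]];
      unfold f1, f2; auto_derive; auto; ring.
  - intros t Htt; assert (A2 := is_sign_sq _ Ha); split.
    + replace (f1 t, f2 t) with (RtoC (1 - t) * RtoC (alpha * s) + RtoC t * (r, y))%C.
      2:{ unfold f1, f2, RtoC, Cmult, Cplus; simpl; f_equal; ring. }
      eapply Rle_lt_trans; [apply Cmod_triangle|].
      rewrite !Cmod_mult, !Cmod_R, Rabs_mult, (is_sign_Rabs alpha) by auto.
      rewrite (Rabs_right s), (Rabs_right t), (Rabs_right (1 - t)) by lra.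
      assert (0 <= (1 - t) * (rho - s)) by (apply Rmult_le_pos; lra).
      assert (0 < t * (rho - Cmod (r, y))) by (apply Rmult_lt_0_compat; lra).
      lra.
    + simpl; unfold f1, f2.
      assert (B : Rabs r = alpha * r).
      { assert (0 < alpha * r) by lra; rewrite <- (Rmult_1_l (Rabs r)), <- (is_sign_Rabs _ Ha).
        rewrite <- Rabs_mult; apply Rabs_right; lra. }
      rewrite B, Rmax_right in H2 by lra.
      assert (B' := Rabs_sign_ge (alpha * s + t * (r - alpha * s))).
      assert (B2 := Rmax_r 0 (Rabs (alpha * s + t * (r - alpha * s)) - s)).
      assert (B3 : t * (alpha * r - s) <=
        Rmax 0 (Rabs (alpha * s + t * (r - alpha * s)) - s)).
      { eapply Rle_trans; [|exact B2].
        replace (t * (alpha * r - s)) with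
          (alpha * (alpha * s + t * (r - alpha * s)) - s); [lra|].
        replace (alpha * (alpha * s + t * (r - alpha * s)) - s) with
          ((alpha * alpha) * s * (1 - t) + t * (alpha * r) - s) by ring.
        rewrite A2; ring. }
      apply (Rmult_le_compat_l delta) in B3; [|lra].
      apply (Rmult_lt_compat_l t) in H2; lra.
Qed.

(** The path is the conic through [alpha s] and [x] with control point near
    [- alpha s] and a weight [w] large enough for the conic to hug the control
    polygon. *)
Lemma conic_path (x : C) : U x -> alpha * Re x < - s ->
  exists gamma dgamma, is_path U (RtoC (alpha * s)) x gamma dgamma.
Proof.
  destruct x as [r y]; intros [H1 H2] Hr; simpl in Hr, H2.
  assert (A2 := is_sign_sq _ Ha); assert (T2 := is_sign_sq _ Ht).
  (* Height of the control point [(- alpha s, tau eta)]; half the gap leaves its modulus, at most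
     [s + eta], below [rho]. *)
  set (eta := (rho - s) / 2).
  assert (He : 0 < eta) by (unfold eta; lra).
  set (r' := - alpha * r); set (y' := tau * y).
  assert (Hr' : s < r') by (unfold r'; lra).
  assert (Er : r = - alpha * r').
  { unfold r'; replace (- alpha * (- alpha * r)) with (alpha * alpha * r) by ring.
    rewrite A2; ring. }
  assert (Ey : y = tau * y').
  { unfold y'; rewrite <- Rmult_assoc, T2; ring. }
  assert (B : Rabs r = r').
  { rewrite Er, Rabs_mult, Rabs_Ropp, is_sign_Rabs by auto; rewrite Rabs_right; lra. }
  rewrite B, Rmax_right in H2 by lra; fold y' in H2.
  (* The lift [2 w eta t (1 - t)] becomes [2 delta r' t (1 - t)], enough to compensate an end point
     below the axis, whose depth is less than [delta (r' - s)]. *)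
  set (w := delta * r' / eta).
  assert (Hw : 0 < w).
  { unfold w; apply Rdiv_lt_0_compat; auto; apply Rmult_lt_0_compat; lra. }
  assert (Ew : w * eta = delta * r') by (unfold w; field; lra).
  set (D := fun t => (1 - t) ^ 2 + 2 * w * t * (1 - t) + t ^ 2).
  assert (HD : forall t, 0 <= t <= 1 -> 0 < D t).
  { intros t Htt; unfold D.
    assert (0 <= w * (t * (1 - t))) by (apply Rmult_le_pos; nra); nra. }
  set (f1 := fun t => alpha * (s * (1 - t) ^ 2 - 2 * w * s * t * (1 - t) - r' * t ^ 2) / D t).
  set (f2 := fun t => tau * (2 * w * eta * t * (1 - t) + y' * t ^ 2) / D t).
  set (D' := fun t => - 2 * (1 - t) + 2 * w * (1 - 2 * t) + 2 * t).
  set (d1 := fun t => alpha * ((- 2 * s * (1 - t) - 2 * w * s * (1 - 2 * t) - 2 * r' * t) * D t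
    - (s * (1 - t) ^ 2 - 2 * w * s * t * (1 - t) - r' * t ^ 2) * D' t) / (D t * D t)).
  set (d2 := fun t => tau * ((2 * w * eta * (1 - 2 * t) + 2 * y' * t) * D t
    - (2 * w * eta * t * (1 - t) + y' * t ^ 2) * D' t) / (D t * D t)).
  exists (fun t => (f1 t, f2 t)), (fun t => (d1 t, d2 t)).
  replace (RtoC (alpha * s)) with (f1 0, f2 0)
    by (unfold f1, f2, D, RtoC; f_equal; field).
  replace (r, y) with (f1 1, f2 1)
    by (unfold f1, f2, D; rewrite Er, Ey; f_equal; field).
  apply (is_path_components U f1 f2 d1 d2).
  - intros t Htt; assert (Dt := HD t Htt).
    assert (DD : D t * D t <> 0) by nra.
    unfold f1, f2, d1, d2, D', D in *; split; [|split; [|split]].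
    + auto_derive; [simpl in Dt; lra|]. field; simpl in Dt |- *; lra.
    + auto_derive; [simpl in Dt; lra|]. field; simpl in Dt |- *; lra.
    + apply (ex_derive_continuous (V := R_NormedModule)); auto_derive; simpl in DD; tauto.
    + apply (ex_derive_continuous (V := R_NormedModule)); auto_derive; simpl in DD; tauto.
  - intros t Htt; assert (Dt := HD t ltac:(lra)); split.
    (* The point is a convex combination of three points of the open disc of radius [rho]: start,
       control point and end. *)
    + replace (f1 t, f2 t) with (RtoC (/ D t) *
        (RtoC ((1 - t) ^ 2) * RtoC (alpha * s) +
         (RtoC (2 * w * t * (1 - t)) * ((- alpha * s)%R, (tau * eta)%R) + RtoC (t ^ 2) * (r, y))))%C.
      2:{ rewrite Er, Ey; unfold f1, f2, RtoC, Cmult, Cplus; simpl; f_equal; field; lra. }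
      rewrite Cmod_mult, Cmod_R, Rabs_right by (left; now apply Rinv_0_lt_compat).
      apply (Rmult_lt_reg_l (D t)); auto.
      rewrite <- Rmult_assoc, Rinv_r, Rmult_1_l by lra.
      eapply Rle_lt_trans; [apply Cmod_triangle|].
      eapply Rle_lt_trans; [apply Rplus_le_compat_l, Cmod_triangle|].
      assert (Cc := Cmod_le_sum (- alpha * s) (tau * eta)).
      rewrite !Rabs_mult, Rabs_Ropp, (is_sign_Rabs alpha), (is_sign_Rabs tau), (Rabs_right s),
        (Rabs_right eta) in Cc by (auto; lra).
      assert (Q0 : 0 <= w * (t * (1 - t))) by (apply Rmult_le_pos; nra).
      rewrite !Cmod_mult, !Cmod_R, Rabs_mult, (is_sign_Rabs alpha), (Rabs_right s) by (auto; lra).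
      rewrite (Rabs_right ((1 - t) ^ 2)), (Rabs_right (2 * w * t * (1 - t))), (Rabs_right (t ^ 2))
        by nra.
      assert (0 <= (1 - t) ^ 2 * (rho - s)) by (apply Rmult_le_pos; [nra|lra]).
      assert (0 < t ^ 2 * (rho - Cmod (r, y))) by (apply Rmult_lt_0_compat; [nra|lra]).
      assert (0 <= (2 * w * t * (1 - t)) * (rho - Cmod (- alpha * s, tau * eta)))
        by (apply Rmult_le_pos; unfold eta in *; nra).
      unfold D; lra.
    + simpl.
      (* [M / D t] is the distance, counted with sign, by which the path has passed the far end
         [- alpha s]. The control point has exactly this abscissa, so [w] cancels in [M]. *)
      set (M := r' * t ^ 2 - s * t ^ 2 - 2 * s * (1 - t) ^ 2).
      assert (EM : - alpha * f1 t - s = M / D t).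
      { unfold f1, M.
        replace (- alpha * (alpha * (s * (1 - t) ^ 2 - 2 * w * s * t * (1 - t) - r' * t ^ 2) / D t)) with
          (- (alpha * alpha) * (s * (1 - t) ^ 2 - 2 * w * s * t * (1 - t) - r' * t ^ 2) / D t)
          by (field; lra).
        rewrite A2; unfold D; unfold D in Dt; field; lra. }
      assert (E2 : tau * f2 t = (2 * (delta * r') * t * (1 - t) + y' * t ^ 2) / D t).
      { unfold f2.
        replace (tau * (tau * (2 * w * eta * t * (1 - t) + y' * t ^ 2) / D t)) with
         ((tau * tau) * (2 * (w * eta) * t * (1 - t) + y' * t ^ 2) / D t) by (field; lra).
        rewrite T2, Ew; field; lra. }
      rewrite E2.
      set (mm := Rmax 0 (Rabs (f1 t) - s)).
      assert (B1 : 0 <= mm) by apply Rmax_l.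
      assert (B2 : M / D t <= mm).
      { rewrite <- EM; eapply Rle_trans; [|apply Rmax_r].
        assert (B' : - alpha * f1 t <= Rabs (f1 t)); [|lra].
        replace (- alpha * f1 t) with (alpha * (- f1 t)) by ring.
        rewrite <- (Rabs_Ropp (f1 t)); apply Rabs_sign_ge. }
      assert (B3 : M <= mm * D t).
      { apply (Rmult_le_compat_r (D t)) in B2; [|lra].
        replace (M / D t * D t) with M in B2 by (field; lra); exact B2. }
      clear B2 EM E2.
      apply (Rmult_lt_reg_r (D t)); auto.
      replace ((2 * (delta * r') * t * (1 - t) + y' * t ^ 2) / D t * D t) with
        (2 * (delta * r') * t * (1 - t) + y' * t ^ 2) by (field; lra).
      assert (K : - (delta * (r' - s)) * t ^ 2 < y' * t ^ 2).
      { apply Rmult_lt_compat_r; [nra|lra]. }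
      assert (B4 : delta * M <= delta * (mm * D t)) by (apply Rmult_le_compat_l; lra).
      assert (B5 : 0 <= delta * (mm * D t)) by (repeat apply Rmult_le_pos; lra).
      assert (EM : M = (r' - s) * t ^ 2 - 2 * s * (1 - t) ^ 2) by (unfold M; ring).
      clearbody M f1 f2 d1 d2 D w.
      remember (r' - s) as l eqn:El.
      set (A := 1 - t) in *.
      assert (HA : 0 <= A) by (unfold A; lra).
      replace r' with (s + l) by (rewrite El; ring).
      assert (Hl : 0 < l) by (rewrite El; lra).
      (* Beyond the far end the allowance [delta M] is available; before it the height itself must
         be positive. With [y' > - delta l], the claims reduce to the two inequalities [Z], where
         the sign of [M] compares [l t^2] with [2 s A^2]. *)
      destruct (Rle_lt_dec 0 M) as [LM|LM].
      * assert (Z : 0 <= A * ((s + l) * t - s * A)).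
        { apply Rmult_le_pos; auto.
          destruct (Rle_lt_dec A t) as [L|L]; [nra|].
          assert (0 <= s * A * (A - t)) by (repeat apply Rmult_le_pos; lra).
          assert (l * t * t >= 2 * s * A * t) by (rewrite EM in LM; nra).
          assert (l * t >= 2 * s * A) by (apply Rle_ge, (Rmult_le_reg_r t); lra).
          nra. }
        apply (Rmult_le_compat_l delta) in Z; [|lra].
        rewrite EM in B4; nra.
      * assert (Z : 0 <= t * (2 * (s + l) * A - l * t)).
        { apply Rmult_le_pos; [lra|].
          destruct (Rle_lt_dec t A) as [L|L]; [nra|].
          assert (0 <= s * A * (t - A)) by (repeat apply Rmult_le_pos; lra).
          assert (l * t * t <= 2 * s * A * t) by (rewrite EM in LM; nra).
          assert (l * t <= 2 * s * A) by (apply (Rmult_le_reg_r t); lra).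
          nra. }
        apply (Rmult_le_compat_l delta) in Z; [|lra].
        nra.
Qed.

End Paths.

(** * Branches on the half-discs *)

Lemma Cmod_lt_sqr (u v r : R) : 0 < r -> (Cmod (u, v) < r <-> u ^ 2 + v ^ 2 < r ^ 2).
Proof.
  intros Hr; unfold Cmod; cbv beta iota delta [fst snd].
  assert (P : 0 <= u ^ 2 + v ^ 2) by nra.
  assert (Q := sqrt_pos (u ^ 2 + v ^ 2)); assert (S := pow2_sqrt _ P); split; intros H; nra.
Qed.

(** Two distinct integer values would force the value [k0 + 1/2] in between. *)
Lemma integer_valued_constant (g : R -> R) :
  (forall t, 0 <= t <= 1 -> continuous g t /\ exists k : Z, g t = IZR k) -> g 0 = g 1.
Proof.
  intros H.
  assert (K : forall h : R -> R,
    (forall t, 0 <= t <= 1 -> continuous h t /\ exists k : Z, h t = IZR k) -> ~ h 0 < h 1).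
  { clear; intros h H L.
    destruct (H 0 ltac:(lra)) as [_ [k0 E0]], (H 1 ltac:(lra)) as [_ [k1 E1]].
    rewrite E0, E1 in L; apply lt_IZR in L.
    destruct (IVT_interv (fun t => h t - (IZR k0 + / 2)) 0 1) as [z [Hz Ez]].
    - intros a Ha; apply continuity_pt_minus.
      + apply continuity_pt_filterlim; now apply H.
      + apply continuity_pt_const; now intros ? ?.
    - lra.
    - rewrite E0; lra.
    - rewrite E1; assert (IZR (k0 + 1) <= IZR k1) by (apply IZR_le; lia).
      rewrite plus_IZR in *; lra.
    - destruct (H z Hz) as [_ [k Ek]]; rewrite Ek in Ez.
      assert (L1 : IZR k0 < IZR k) by lra; assert (L2 : IZR k < IZR (k0 + 1)).
      { rewrite plus_IZR; lra. }
      apply lt_IZR in L1, L2; lia. }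
  destruct (Rtotal_order (g 0) (g 1)) as [L|[L|L]]; auto.
  - now destruct (K g H).
  - destruct (K (fun t => - g t)); [|lra].
    intros t Ht; destruct (H t Ht) as [A [k B]]; split.
    + now apply (continuous_opp (V := R_NormedModule)).
    + exists (- k)%Z; now rewrite opp_IZR, B.
Qed.

Lemma is_derive_segment (x w : C) (t : R) : cderiv (fun u => x + RtoC u * w)%C t w.
Proof.
  apply is_derive_C_pair; destruct x as [x1 x2], w as [w1 w2]; simpl; split;
    auto_derive; auto; ring.
Qed.

(** Here [D] stands for a difference of two logarithms of one function; its values lie in
    [2 pi i Z], and the integer is continuous along the segment. *)
Lemma periods_constant_segment (U : C -> Prop) (D : C -> C) (x y : C) :
  (forall z, U z -> @continuous C_UniformSpace C_UniformSpace D z /\ Cexp (D z) = 1%C) ->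
  (forall t, 0 <= t <= 1 -> U (x + RtoC t * (y - x))%C) -> D x = D y.
Proof.
  intros HD HU.
  set (gamma := fun t => (x + RtoC t * (y - x))%C).
  assert (P := PI_RGT_0).
  assert (G0 : gamma 0 = x) by (unfold gamma; ring).
  assert (G1 : gamma 1 = y) by (unfold gamma; ring).
  assert (H : forall t, 0 <= t <= 1 -> exists k : Z,
    fst (D (gamma t)) = 0 /\ snd (D (gamma t)) = 2 * PI * IZR k).
  { intros t Ht; destruct (Cexp_eq_1 (D (gamma t))) as [k ->]; [now apply HD, HU|].
    exists k; simpl; split; ring. }
  assert (I : snd (D (gamma 0)) * / (2 * PI) = snd (D (gamma 1)) * / (2 * PI)).
  { apply (integer_valued_constant (fun t => snd (D (gamma t)) * / (2 * PI))).
    intros t Ht; split.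
    - apply (continuous_mult (K := R_AbsRing)); [|apply continuous_const].
      assert (K : @continuous R_UniformSpace C_UniformSpace (fun t => D (gamma t)) t);
        [|now apply continuous_C_pair in K].
      apply (continuous_along D gamma t (y - x)%C); [|now apply HD, HU].
      apply is_derive_segment.
    - destruct (H t Ht) as [k [_ ->]]; exists k; field; lra. }
  destruct (H 0 ltac:(lra)) as [k0 [E0 _]], (H 1 ltac:(lra)) as [k1 [E1 _]].
  apply Rmult_eq_reg_r in I; [|apply Rinv_neq_0_compat; lra].
  rewrite <- G0, <- G1, (surjective_pairing (D (gamma 0))), (surjective_pairing (D (gamma 1))).
  now rewrite I, E0, E1.
Qed.

Section Branches.
Variables (s rho delta tau : R).
Hypotheses (Hs : 0 < s < rho) (Hd : 0 < delta) (Ht : is_sign tau).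
Let U := half_disc s rho delta tau.
Let c0 : C := (0, tau * (rho / 2)).

Lemma half_disc_upper (u v : R) : u ^ 2 + v ^ 2 < rho ^ 2 -> 0 < tau * v -> U (u, v).
Proof.
  intros H1 H2; split; [apply Cmod_lt_sqr; lra|]; simpl.
  assert (0 <= delta * Rmax 0 (Rabs u - s)); [|lra].
  apply Rmult_le_pos; [lra|apply Rmax_l].
Qed.

(** The half-disc omits the segment [[-s, s]], the set on which [(x - s) / (x + s)] could meet the
    cut of [Clog]. *)
Lemma half_disc_axis (u v : R) : U (u, v) -> v = 0 -> s ^ 2 < u ^ 2.
Proof.
  intros [_ H] ->; simpl in H.
  destruct (Rle_lt_dec (Rabs u) s) as [L|L].
  - rewrite Rmax_left in H; lra.
  - rewrite <- (Rsqr_pow2 u), Rsqr_abs, Rsqr_pow2; nra.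
Qed.

(** Two steps join [x] to [c0] inside [U]: a vertical segment into the open half
    plane [0 < tau * Im x], then a segment in the convex half-disc. *)
Lemma periods_constant_half_disc (D : C -> C) :
  (forall z, U z -> @continuous C_UniformSpace C_UniformSpace D z /\ Cexp (D z) = 1%C) ->
  forall x, U x -> D x = D c0.
Proof.
  intros HD.
  assert (T2 := is_sign_sq _ Ht).
  assert (Up : forall u v, u ^ 2 + v ^ 2 < rho ^ 2 -> 0 < tau * v ->
    D (u, v) = D c0).
  { intros u v H1 H2; apply (periods_constant_segment U); auto.
    intros t Htt; replace ((u, v) + RtoC t * (c0 - (u, v)))%C with
      ((1 - t) * u, (1 - t) * v + t * (tau * (rho / 2)) : R).
    2:{ unfold c0, Cmult, Cminus, Cplus, Copp, RtoC; simpl; f_equal; ring. }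
    set (w := tau * (rho / 2)).
    assert (W2 : w ^ 2 = rho ^ 2 / 4).
    { unfold w; replace ((tau * (rho / 2)) ^ 2) with ((tau * tau) * rho ^ 2 / 4) by field.
      rewrite T2; field. }
    assert (W1 : tau * w = rho / 2).
    { unfold w; rewrite <- Rmult_assoc, T2; ring. }
    apply half_disc_upper.
    - assert (V : 2 * v * w <= v ^ 2 + w ^ 2) by (assert (V := pow2_ge_0 (v - w)); lra).
      assert (P0 : 0 <= t * (1 - t)) by nra.
      assert (0 <= t * (1 - t) * (v ^ 2 + w ^ 2 - 2 * v * w)) by (apply Rmult_le_pos; lra).
      assert (0 <= t * (1 - t) * u ^ 2) by (apply Rmult_le_pos; nra).
      (* Convexity of the squared modulus, written as an identity with explicit nonnegative
         defects. *)
      replace (((1 - t) * u) ^ 2 + ((1 - t) * v + t * w) ^ 2) with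
        ((1 - t) * (u ^ 2 + v ^ 2) + t * w ^ 2 - t * (1 - t) * u ^ 2
         - t * (1 - t) * (v ^ 2 + w ^ 2 - 2 * v * w)) by ring.
      rewrite W2; assert (0 < rho ^ 2) by nra.
      destruct (Req_dec t 1) as [->|N]; [lra|].
      assert ((1 - t) * (u ^ 2 + v ^ 2) < (1 - t) * rho ^ 2) by (apply Rmult_lt_compat_l; lra).
      nra.
    - replace (tau * ((1 - t) * v + t * w)) with ((1 - t) * (tau * v) + t * (tau * w)) by ring.
      rewrite W1.
      destruct (Req_dec t 1) as [->|N]; [lra|].
      assert (0 < (1 - t) * (tau * v)) by (apply Rmult_lt_0_compat; lra).
      assert (0 <= t * (rho / 2)) by (apply Rmult_le_pos; lra); lra. }
  intros [u v] Hx.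
  destruct (Rlt_le_dec 0 (tau * v)) as [L|L].
  { apply Up; auto; apply Cmod_lt_sqr; [lra | apply Hx]. }
  assert (C1 : u ^ 2 + v ^ 2 < rho ^ 2) by (apply Cmod_lt_sqr; [lra | apply Hx]).
  assert (Cu : Rabs u < rho).
  { apply Rabs_def1; nra. }
  assert (Eta : exists eta, 0 < eta /\ u ^ 2 + eta ^ 2 < rho ^ 2).
  { exists ((rho - Rabs u) / 2); split; [lra|].
    rewrite <- (Rsqr_pow2 u), Rsqr_abs, Rsqr_pow2.
    assert (P := Rabs_pos u); nra. }
  destruct Eta as [eta [He1 He2]].
  rewrite <- (Up u (tau * eta)).
  2:{ replace ((tau * eta) ^ 2) with ((tau * tau) * eta ^ 2) by ring; rewrite T2; lra. }
  2:{ rewrite <- Rmult_assoc, T2; lra. }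
  apply (periods_constant_segment U); auto.
  intros t Htt; replace ((u, v) + RtoC t * ((u, (tau * eta)%R) - (u, v)))%C with
    (u, v + t * (tau * eta - v) : R).
  2:{ unfold Cmult, Cminus, Cplus, Copp, RtoC; simpl; f_equal; ring. }
  destruct Hx as [_ Hx]; simpl in Hx; split; simpl.
  - apply Cmod_lt_sqr; [lra|].
    assert (W : (tau * eta) ^ 2 = eta ^ 2).
    { replace ((tau * eta) ^ 2) with ((tau * tau) * eta ^ 2) by ring; rewrite T2; lra. }
    set (w := tau * eta) in *.
    assert (0 <= t * (1 - t) * (v - w) ^ 2) by (apply Rmult_le_pos; [apply Rmult_le_pos; lra | apply pow2_ge_0]).
    replace (u ^ 2 + (v + t * (w - v)) ^ 2) with
      ((1 - t) * (u ^ 2 + v ^ 2) + t * (u ^ 2 + w ^ 2) - t * (1 - t) * (v - w) ^ 2) by ring.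
    rewrite W; destruct (Req_dec t 1) as [->|N]; [lra|].
    assert ((1 - t) * (u ^ 2 + v ^ 2) < (1 - t) * rho ^ 2) by (apply Rmult_lt_compat_l; lra).
    assert (t * (u ^ 2 + eta ^ 2) <= t * rho ^ 2) by (apply Rmult_le_compat_l; lra).
    lra.
  - replace (tau * (v + t * (tau * eta - v))) with
      (tau * v + t * ((tau * tau) * eta - tau * v)) by ring.
    rewrite T2; assert (0 <= t * (1 * eta - tau * v)) by (apply Rmult_le_pos; lra); lra.
Qed.

(** The difference of the logarithms exponentiates to 1, hence is a period, and periods are constant
    on the half-disc. *)
Lemma log_branch_unique (g lambda mu : C -> C) :
  log_branch U g lambda -> log_branch U g mu -> (forall x, U x -> g x <> 0%C) ->
  exists K : C, forall x, U x -> lambda x = (mu x + K)%C.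
Proof.
  intros Hl Hm Hg; exists (lambda c0 - mu c0)%C.
  intros x Hx.
  assert (E := periods_constant_half_disc (fun x => lambda x - mu x)%C).
  cbv beta in E; rewrite <- (E) with (x := x); auto; [ring|].
  intros z Hz; destruct (Hl z Hz) as [A A'], (Hm z Hz) as [B B']; split.
  - now apply continuous_Cminus.
  - unfold Cminus; rewrite Cexp_add, Cexp_opp, A', B'; field; auto.
Qed.

(** The pair is [g] times the conjugate of [h], which differs from [g / h] by the positive factor
    [|h|^2]. *)
Lemma slit_quotient (g h : C) : h <> 0%C ->
  slit (g / h)%C <-> slit (fst g * fst h + snd g * snd h, snd g * fst h - fst g * snd h).
Proof.
  intros Hh; assert (N := Rsqr_Cmod_neq_0 _ Hh).
  destruct g as [a b], h as [c d]; unfold slit; cbv beta iota delta [fst snd] in N |- *.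
  assert (I := Rinv_0_lt_compat _ N).
  replace (Cdiv (a, b) (c, d)) with
    ((a * c + b * d) * / (c ^ 2 + d ^ 2), (b * c - a * d) * / (c ^ 2 + d ^ 2)).
  2:{ unfold Cdiv, Cinv, Cmult; simpl; f_equal; field; simpl in N; lra. }
  cbv beta iota delta [fst snd]; split; intros [H|H]; [left|right|left|right].
  - apply (Rmult_lt_reg_r (/ (c ^ 2 + d ^ 2))); lra.
  - intros E; apply H; rewrite E; ring.
  - now apply Rmult_lt_0_compat.
  - apply Rmult_integral_contrapositive_currified; lra.
Qed.

Lemma half_disc_neq (x : C) (e : R) : U x -> e = s \/ e = - s -> x <> RtoC e.
Proof.
  intros Hx He E; subst x.
  assert (H := half_disc_axis _ _ Hx eq_refl); destruct He as [-> | ->]; nra.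
Qed.

Lemma half_disc_minus_neq_0 (x : C) : U x -> (x - RtoC s)%C <> 0%C.
Proof. intros Hx; apply Cminus_neq_0, half_disc_neq; auto. Qed.

Lemma half_disc_plus_neq_0 (x : C) : U x -> (x + RtoC s)%C <> 0%C.
Proof.
  intros Hx; replace (x + RtoC s)%C with (x - RtoC (- s))%C by (rewrite RtoC_opp; ring).
  apply Cminus_neq_0, half_disc_neq; auto.
Qed.

(** Up to a positive factor the quotient is [|x|^2 - s^2 + 2 i s Im x], which is nonpositive real
    only on the cut [[-s, s]]. *)
Lemma slit_ratio (x : C) : U x -> slit ((x - RtoC s) / (x + RtoC s))%C.
Proof.
  intros Hx; apply slit_quotient; [now apply half_disc_plus_neq_0|].
  destruct x as [u v]; unfold slit; simpl.
  destruct (Req_dec v 0) as [E|E].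
  - left; assert (H := half_disc_axis _ _ Hx E); subst v; nra.
  - right; assert (A : s * v <> 0) by (apply Rmult_integral_contrapositive_currified; lra).
    intros Z; apply A; lra.
Qed.

Variable X : R.
Hypothesis HX : rho < X.

Lemma disc_neq (x : C) : Cmod x < rho -> (RtoC X - x)%C <> 0%C.
Proof.
  intros Hx; apply Cminus_neq_0; intros E; rewrite <- E, Cmod_R, Rabs_right in Hx; lra.
Qed.

(** The real part has the sign of [X^2 - |x|^2]. *)
Lemma slit_outer (x : C) : Cmod x < rho -> slit ((RtoC X + x) / (RtoC X - x))%C.
Proof.
  intros Hx; apply slit_quotient; [now apply disc_neq|].
  destruct x as [u v]; apply Cmod_lt_sqr in Hx; [|lra].
  left; simpl; nra.
Qed.

Definition ratio (x : C) : C := ((x - RtoC s) / (x + RtoC s))%C.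
Definition outer (x : C) : C := ((RtoC X + x) / (RtoC X - x))%C.

Lemma log_branch_ratio : log_branch U ratio (fun x => Clog (ratio x)).
Proof.
  intros x Hx; split; [|now apply Cexp_Clog, slit_ratio].
  apply (continuous_comp ratio Clog); [|now apply continuous_Clog, slit_ratio].
  apply continuous_Cdiv; [| |now apply half_disc_plus_neq_0].
  - apply continuous_Cminus; [apply continuous_id | apply continuous_const].
  - apply continuous_Cplus; [apply continuous_id | apply continuous_const].
Qed.

Lemma log_branch_outer : log_branch U outer (fun x => Clog (outer x)).
Proof.
  intros x [Hx _]; split; [|now apply Cexp_Clog, slit_outer].
  apply (continuous_comp outer Clog); [|now apply continuous_Clog, slit_outer].
  apply continuous_Cdiv; [| |now apply disc_neq].
  - apply continuous_Cplus; [apply continuous_const | apply continuous_id].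
  - apply continuous_Cminus; [apply continuous_const | apply continuous_id].
Qed.

Definition ratio_log (B G : C) (x : C) : C :=
  (B * Clog (ratio x) + G * Clog (outer x))%C.

Lemma outer_branch_explicit (G : C) h : power_branch U outer G h ->
  exists K : C, forall x, U x -> h x = Cexp (G * Clog (outer x) + K)%C.
Proof.
  intros [lambda [Hl Hh]].
  destruct (log_branch_unique _ _ _ Hl log_branch_outer) as [K HK].
  { intros x [Hx _]; now apply slit_neq_0, slit_outer. }
  exists (G * K)%C; intros x Hx; rewrite Hh, HK by auto.
  apply (f_equal Cexp); ring.
Qed.

Lemma phi1_explicit (B G : C) f h :
  power_branch U ratio B f -> power_branch U outer G h ->
  exists K : C, K <> 0%C /\ forall x, U x -> (f x * h x)%C = (K * Cexp (ratio_log B G x))%C.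
Proof.
  intros [lambda [Hl Hf]] Hh.
  destruct (outer_branch_explicit _ _ Hh) as [K HK].
  destruct (log_branch_unique _ _ _ Hl log_branch_ratio) as [K' HK'].
  { intros x Hx; now apply slit_neq_0, slit_ratio. }
  exists (Cexp (B * K' + K)%C); split; [apply Cexp_neq_0|].
  intros x Hx; rewrite Hf, HK, HK' by auto; rewrite <- !Cexp_add.
  apply (f_equal Cexp); unfold ratio_log; ring.
Qed.

(** The logarithms [m1], [m2] of [x - s] and [x + s] need no explicit form: [(B - 1) m1 - (B + 1) m2
    = B (m1 - m2) - m1 - m2], where [m1 - m2] is a logarithm of the ratio and the rest produces the
    denominator. *)
Lemma phi2_explicit (B G : C) f1 f2 h :
  power_branch U (fun x => x - RtoC s)%C (B - 1)%C f1 ->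
  power_branch U (fun x => x + RtoC s)%C (B + 1)%C f2 -> power_branch U outer G h ->
  exists K : C, K <> 0%C /\ forall x, U x ->
    (f1 x / f2 x * h x)%C =
    (K * Cexp (ratio_log B G x) / ((x - RtoC s) * (x + RtoC s)))%C.
Proof.
  intros [m1 [Hm1 Hf1]] [m2 [Hm2 Hf2]] Hh.
  destruct (outer_branch_explicit _ _ Hh) as [K HK].
  assert (Hl : log_branch U ratio (fun x => m1 x - m2 x)%C).
  { intros x Hx; destruct (Hm1 x Hx) as [A A'], (Hm2 x Hx) as [C C']; split.
    - now apply continuous_Cminus.
    - unfold Cminus; rewrite Cexp_add, Cexp_opp, A', C'; reflexivity. }
  destruct (log_branch_unique _ _ _ Hl log_branch_ratio) as [K' HK'].
  { intros x Hx; now apply slit_neq_0, slit_ratio. }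
  exists (Cexp (B * K' + K)%C); split; [apply Cexp_neq_0|].
  intros x Hx; rewrite Hf1, Hf2, HK by auto.
  destruct (Hm1 x Hx) as [_ E1], (Hm2 x Hx) as [_ E2]; rewrite <- E1, <- E2.
  unfold Cdiv; rewrite <- !Cexp_add, <- !Cexp_opp, <- !Cexp_add.
  apply (f_equal Cexp); unfold ratio_log.
  specialize (HK' x Hx); cbv beta in HK'.
  replace (Clog (ratio x)) with (m1 x - m2 x - K')%C by (rewrite HK'; ring); ring.
Qed.

End Branches.

(** * Residues *)

Lemma Cexp_Ci (t : R) : Cexp (Ci * RtoC t)%C = (cos t, sin t).
Proof.
  unfold Cexp; replace (Ci * RtoC t)%C with (0, t).
  - simpl; rewrite exp_0; unfold Cmult, RtoC; simpl; f_equal; ring.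
  - unfold Ci, Cmult, RtoC; simpl; f_equal; ring.
Qed.

Definition circle (c : C) (r t : R) : C := (c + RtoC r * Cexp (Ci * RtoC t))%C.

Lemma is_derive_circle c r t :
  cderiv (circle c r) t (Ci * (RtoC r * Cexp (Ci * RtoC t)))%C.
Proof.
  apply (cderiv_ext (fun t => c + RtoC r * (cos t, sin t))%C).
  { intros u; unfold circle; now rewrite Cexp_Ci. }
  rewrite Cexp_Ci; destruct c as [c1 c2].
  apply is_derive_C_pair; simpl; split; auto_derive; auto; ring.
Qed.

Lemma Cmod_circle (r t : R) : 0 < r -> Cmod (RtoC r * Cexp (Ci * RtoC t))%C = r.
Proof.
  intros Hr; rewrite Cmod_mult, Cmod_R, Rabs_right, Cexp_Ci by lra.
  unfold Cmod; simpl; assert (E := sin2_cos2 t); unfold Rsqr in E.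
  replace (cos t * (cos t * 1) + sin t * (sin t * 1)) with 1 by lra.
  rewrite sqrt_1; ring.
Qed.

Lemma circle_2PI c r : circle c r (2 * PI) = circle c r 0.
Proof. unfold circle; now rewrite !Cexp_Ci, cos_2PI, sin_2PI, cos_0, sin_0. Qed.

(** On the circle, [H] returns to its initial value and [d / (x - c)] contributes the constant speed
    [i d]; their sum [f] is a primitive of the integrand. *)
Lemma is_residue_primitive (V : C -> Prop) (H Q : C -> C) (c d : C) (r0 : R) :
  0 < r0 ->
  (forall z, 0 < Cmod (z - c)%C < r0 -> V z) ->
  primitive_on V H (fun x => Q x - d / (x - c))%C ->
  (forall z, V z -> @continuous C_UniformSpace C_UniformSpace Q z) ->
  is_residue Q c d.
Proof.
  intros Hr0 HV HH HQ; exists r0; split; auto; intros r Hr; cbv zeta.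
  assert (Hw : forall t, (RtoC r * Cexp (Ci * RtoC t))%C <> 0%C).
  { intros t E; assert (M := Cmod_circle r t ltac:(lra)); rewrite E, Cmod_0 in M; lra. }
  assert (Hc : forall t, V (circle c r t)).
  { intros t; apply HV; unfold circle.
    replace (c + RtoC r * Cexp (Ci * RtoC t) - c)%C with (RtoC r * Cexp (Ci * RtoC t))%C by ring.
    rewrite Cmod_circle; lra. }
  set (f := fun t => (H (circle c r t) + RtoC t * (Ci * d))%C).
  replace (RtoC (2 * PI) * Ci * d)%C with (f (2 * PI)%R - f 0)%C.
  2:{ unfold f; rewrite circle_2PI; ring. }
  apply (is_RInt_derive (V := C_R_CompleteNormedModule) f
    (fun t => Q (circle c r t) * (Ci * (RtoC r * Cexp (Ci * RtoC t))))%C).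
  - intros t _; unfold f.
    destruct (HH _ (Hc t)) as [_ HD].
    specialize (HD (circle c r) t _ eq_refl (is_derive_circle c r t)).
    replace (Q (circle c r t) * (Ci * (RtoC r * Cexp (Ci * RtoC t))))%C with
     ((Q (circle c r t) - d / (circle c r t - c)) * (Ci * (RtoC r * Cexp (Ci * RtoC t))) + Ci * d)%C.
    + apply (is_derive_Cplus (fun t => H (circle c r t))); auto.
      apply (cderiv_ext (fun u => 0 + RtoC u * (Ci * d))%C); [intros; ring|].
      apply is_derive_segment.
    + replace (circle c r t - c)%C with (RtoC r * Cexp (Ci * RtoC t))%C
        by (unfold circle; ring).
      field; specialize (Hw t); split; intros E; apply Hw; rewrite E; ring.
  - intros t _.
    apply (continuous_Cmult (fun t => Q (circle c r t))).
    + apply (continuous_along Q _ _ _ (is_derive_circle c r t)); auto.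
    + assert (E : forall u, (Ci * (circle c r u - c))%C = (Ci * (RtoC r * Cexp (Ci * RtoC u)))%C)
        by (intros u; unfold circle; ring).
      apply (continuous_ext _ _ _ E); clear E.
      apply continuous_Cmult; [apply continuous_const|].
      apply continuous_Cminus; [|apply continuous_const].
      apply (ex_derive_continuous (V := C_R_NormedModule) (circle c r)).
      eexists; apply is_derive_circle.
Qed.

Lemma is_residue_unique (Q Q' : C -> C) (c d d' : C) (e : R) :
  0 < e -> (forall x, 0 < Cmod (x - c)%C < e -> Q x = Q' x) ->
  is_residue Q c d -> is_residue Q' c d' -> d = d'.
Proof.
  intros He EQ [r [Hr R1]] [r' [Hr' R2]].
  set (u := Rmin e (Rmin r r') / 2).
  assert (Hu : 0 < u /\ u < e /\ u < r /\ u < r').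
  { assert (0 < Rmin e (Rmin r r')) by (repeat apply Rmin_pos; auto).
    assert (A1 := Rmin_l e (Rmin r r')); assert (A2 := Rmin_r e (Rmin r r')).
    assert (A3 := Rmin_l r r'); assert (A4 := Rmin_r r r'); unfold u; lra. }
  specialize (R1 u ltac:(lra)); specialize (R2 u ltac:(lra)); cbv zeta in R1, R2.
  apply (is_RInt_ext (V := C_R_NormedModule) _ (fun t =>
    Q' (c + RtoC u * Cexp (Ci * RtoC t))%C * (Ci * (RtoC u * Cexp (Ci * RtoC t))))%C) in R1.
  2:{ intros t _; rewrite EQ; auto.
      replace (c + RtoC u * Cexp (Ci * RtoC t) - c)%C with (RtoC u * Cexp (Ci * RtoC t))%C by ring.
      rewrite Cmod_circle; lra. }
  apply (is_RInt_unique (V := C_R_CompleteNormedModule)) in R1.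
  apply (is_RInt_unique (V := C_R_CompleteNormedModule)) in R2.
  assert (E := eq_trans (eq_sym R1) R2).
  assert (N : (RtoC (2 * PI) * Ci)%C <> 0%C).
  { assert (PP := PI_RGT_0); unfold Ci, Cmult, RtoC; simpl; intros Z; injection Z; lra. }
  transitivity (/ (RtoC (2 * PI) * Ci) * (RtoC (2 * PI) * Ci * d))%C.
  - field; split; intros Z; apply N; rewrite Z; ring.
  - rewrite E; field; split; intros Z; apply N; rewrite Z; ring.
Qed.

(** A ball inside [U] is enough for [rational_identity] to carry the agreement of two rational
    continuations over to a punctured neighbourhood of [c]. *)
Lemma Res_eq (U : C -> Prop) (Q q : C -> C) (c d b : C) (r : R) :
  0 < r -> (forall x, Cmod (x - b)%C < r -> U x) ->
  is_rational Q -> (forall x, U x -> Q x = q x) -> is_residue Q c d -> Res U q c = d.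
Proof.
  intros Hr HU HQ Hq Hd; apply (iota_unique (V := C_R_CompleteNormedModule)).
  - intros d' [Q' [HQ' [Hq' Hd']]].
    destruct (rational_identity Q' Q b r HQ' HQ Hr) with (a := c) as [e [He EQ]].
    + intros x Hx; rewrite Hq, Hq' by auto; reflexivity.
    + now apply (is_residue_unique Q' Q c d' d e).
  - exists Q; auto.
Qed.

(** * The quotient of the two solutions *)

Lemma Cinv_0 : (/ 0)%C = 0%C.
Proof. unfold Cinv, RtoC; simpl; f_equal; unfold Rdiv; ring. Qed.

(** Multiplicativity also holds at [0], where Rocq's inverse is [0]. *)
Lemma Cinv_mult_total (u v : C) : (/ (u * v))%C = (/ u * / v)%C.
Proof.
  destruct (classic (u = 0%C)) as [->|Hu].
  { rewrite Cmult_0_l, Cinv_0; ring. }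
  destruct (classic (v = 0%C)) as [->|Hv].
  { rewrite Cmult_0_r, Cinv_0; ring. }
  field; auto.
Qed.

Section Quotient.
Variables (s rho X delta alpha es : R) (K : C) (N n : nat).
Hypotheses (Hs : 0 < s < rho) (HX : rho < X) (Hd : 0 < delta).
Hypotheses (Ha : is_sign alpha) (Hes : is_sign es).

Let a : C := RtoC (alpha * s).
Let p : C := RtoC (- (alpha * s)).
Let e : C := RtoC (es * X).

(** The common continuation of [Phi_2 / Phi_1]: [a] is the base point, [p] the
    pole inside the disc and [e] the pole at [+-1 / sqrt eps]. *)
Definition quotient (x : C) : C :=
  (K * ((x - a) ^ N * (x + e) ^ n) *
   bimonomial p e (- Z.of_nat (S (S N))) (- Z.of_nat n) x)%C.

Let V (x : C) : Prop := Cmod x < X /\ x <> p.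

Lemma alpha_s_neq_0 : alpha * s <> 0.
Proof.
  apply Rmult_integral_contrapositive_currified; [now apply is_sign_neq_0 | lra].
Qed.

Lemma Cmod_a : Cmod a = s.
Proof.
  unfold a; rewrite Cmod_R, Rabs_mult, is_sign_Rabs, Rabs_right by (auto; lra); ring.
Qed.

Lemma Cmod_p : Cmod p = s.
Proof. rewrite <- Cmod_a; unfold a, p; rewrite !Cmod_R; apply Rabs_Ropp. Qed.

Lemma Cmod_e : Cmod e = X.
Proof.
  unfold e; rewrite Cmod_R, Rabs_mult, is_sign_Rabs, Rabs_right by (auto; lra); ring.
Qed.

Lemma V_neq_e x : V x -> x <> e.
Proof. intros [H _] ->; rewrite Cmod_e in H; lra. Qed.

Lemma p_neq_e : p <> e.
Proof. intros E; assert (A := Cmod_p); rewrite E, Cmod_e in A; lra. Qed.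

Lemma polyfun_numerator : exists k, polyfun k (fun x => K * ((x - a) ^ N * (x + e) ^ n))%C.
Proof.
  exists (N * 1 + n * 1)%nat; apply polyfun_scal, polyfun_mult; apply polyfun_pow.
  - apply (polyfun_ext _ (fun x => 1 * x + - a)%C); [intros; ring|apply polyfun_linear].
  - apply (polyfun_ext _ (fun x => 1 * x + e)%C); [intros; ring|apply polyfun_linear].
Qed.

Lemma is_rational_quotient : is_rational quotient.
Proof.
  destruct polyfun_numerator as [k Hk]; apply polyfun_coeffs in Hk; destruct Hk as [c Hc].
  assert (HD : polyfun (S (S N) * 1 + n * 1) (fun x => (x - p) ^ S (S N) * (x - e) ^ n)%C).
  { apply polyfun_mult; apply polyfun_pow.
    - apply (polyfun_ext _ (fun x => 1 * x + - p)%C); [intros; ring|apply polyfun_linear].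
    - apply (polyfun_ext _ (fun x => 1 * x + - e)%C); [intros; ring|apply polyfun_linear]. }
  apply polyfun_coeffs in HD; destruct HD as [d Hd'].
  exists k, (S (S N) * 1 + n * 1)%nat, c, d; split.
  - apply NNPP; intros NE.
    assert (Z : forall j, (j <= S (S N) * 1 + n * 1)%nat -> d j = 0%C).
    { intros j Hj; apply NNPP; intros Hn; apply NE; now exists j. }
    (* The base point differs from both poles, so the denominator is nonzero there and its
       coefficients cannot all vanish. *)
    assert (P0 : polynomial (S (S N) * 1 + n * 1) d a = 0%C) by now apply polynomial_zero.
    revert P0; rewrite <- Hd'; apply Cmult_neq_0; apply Cpow_nz, Cminus_neq_0.
    + unfold a, p; intros E; injection E; assert (Y := alpha_s_neq_0); lra.
    + intros E; assert (A := Cmod_a); rewrite E, Cmod_e in A; lra.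
  - intros x; unfold quotient, bimonomial; rewrite <- Hc, <- Hd', !zpow_opp.
    (* [is_rational] demands equality at every point, the poles included. *)
    unfold Cdiv; now rewrite Cinv_mult_total.
Qed.

Lemma continuous_quotient x : V x ->
  @continuous C_UniformSpace C_UniformSpace quotient x.
Proof.
  intros Hx; destruct polyfun_numerator as [k Hk].
  assert (L : forall c : C, @continuous C_UniformSpace C_UniformSpace (fun x => x - c)%C x).
  { intros c; apply continuous_Cminus; [apply continuous_id | apply continuous_const]. }
  apply continuous_Cmult; [now apply (polyfun_continuous k)|].
  unfold bimonomial; apply continuous_Cmult.
  - apply (continuous_zpow (fun x => x - p)%C); auto; apply Cminus_neq_0, Hx.
  - apply (continuous_zpow (fun x => x - e)%C); auto; now apply Cminus_neq_0, V_neq_e.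
Qed.

(** The normalised argument is [1 - x / e], which has positive real part for [|x| < X] whichever
    sign [e] has. *)
Lemma primitive_inv_e : primitive_on V (fun x => Clog ((x - e) / - e)%C) (fun x => / (x - e))%C.
Proof.
  intros x Hx.
  assert (E0 : e <> 0%C).
  { intros E; assert (A := Cmod_e); rewrite E, Cmod_0 in A; lra. }
  assert (Nx := Cminus_neq_0 _ _ (V_neq_e _ Hx)).
  assert (Sl : slit ((x - e) / - e)%C).
  { destruct Hx as [Hx _]; destruct x as [u v]; apply Cmod_lt_sqr in Hx; [|lra].
    left; replace (((u, v) - e) / - e)%C with (RtoC (/ (es * X)) * (e - (u, v)))%C.
    2:{ rewrite RtoC_inv by (destruct Hes as [-> | ->]; lra); fold e; field; auto. }
    unfold e; simpl.
    assert (I : 0 < / X) by (apply Rinv_0_lt_compat; lra).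
    assert (u < X /\ - X < u) by nra.
    destruct Hes as [-> | ->].
    - replace (/ (1 * X)) with (/ X) by (field; lra); nra.
    - replace (/ (-1 * X)) with (- / X) by (field; lra); nra. }
  split.
  - apply (continuous_comp (fun x => (x - e) / - e)%C Clog); [|now apply continuous_Clog].
    apply continuous_Cmult; [|apply continuous_const].
    apply continuous_Cminus; [apply continuous_id | apply continuous_const].
  - intros gamma t l Et Hl.
    replace (/ (x - e) * l)%C with ((l * (/ - e) + (gamma t - e) * 0) / ((gamma t - e) / - e))%C.
    + apply (is_derive_Clog (fun u => (gamma u - e) / - e)%C); [now rewrite Et|].
      apply (is_derive_Cmult (fun u => gamma u - e)%C (fun _ => / - e)%C).
      * now apply is_derive_sub_const.
      * apply is_derive_C_const.
    + rewrite Et; field; auto.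
Qed.

Lemma log_primitive_quotient : log_primitive V p quotient.
Proof.
  destruct polyfun_numerator as [k Hk].
  apply (log_primitive_rational V p e) with (n := k); auto.
  - now intros x [_ Hx].
  - exact V_neq_e.
  - exact p_neq_e.
  - eexists; apply primitive_inv_e.
Qed.

Variables (d : C) (G : C -> C).
Hypothesis HG : primitive_on V G (fun x => quotient x - d / (x - p))%C.

Let Vt (tau : R) (x : C) : Prop := Cmod x < X /\ tslit tau (x - p)%C.

Definition quotient_primitive (tau : R) (x : C) : C := (G x + d * slog tau (x - p))%C.

Lemma Vt_V tau x : is_sign tau -> Vt tau x -> V x.
Proof.
  intros Ht [H1 H2]; split; auto; intros ->.
  replace (p - p)%C with (RtoC 0) in H2 by ring.
  destruct H2 as [H2|H2]; simpl in H2; lra.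
Qed.

Lemma primitive_quotient tau : is_sign tau ->
  primitive_on (Vt tau) (quotient_primitive tau) quotient.
Proof.
  intros Ht.
  apply (primitive_ext _ _ (fun x => (quotient x - d / (x - p)) + d * / (x - p))%C).
  { intros x Hx; field; apply Cminus_neq_0; now apply (Vt_V tau). }
  apply (primitive_plus (Vt tau) G (fun x => d * slog tau (x - p))%C).
  { revert HG; apply primitive_sub; intros x; now apply Vt_V. }
  apply (primitive_scal (Vt tau) (fun x => slog tau (x - p))%C).
  intros x [_ Hx]; split.
  - apply (continuous_comp (fun x => x - p)%C (slog tau)); [|now apply continuous_slog].
    apply continuous_Cminus; [apply continuous_id | apply continuous_const].
  - intros gamma t l <- Hl; rewrite Cmult_comm.
    apply (is_derive_slog tau (fun u => gamma u - p)%C); auto.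
    now apply is_derive_sub_const.
Qed.

Lemma tslit_re tau (x : C) : Re x <> Re p -> tslit tau (x - p)%C.
Proof. intros H; right; destruct x; simpl in *; lra. Qed.

(** On the vertical line through [p] the enlargement has width 0, because [|Re p| = s]; there the
    half-disc lies strictly on the side [tau], away from the cut. *)
Lemma half_disc_Vt tau x : is_sign tau -> half_disc s rho delta tau x -> Vt tau x.
Proof.
  intros Ht [H1 H2]; split; [lra|].
  destruct (Req_dec (Re x) (Re p)) as [E|E]; [|now apply tslit_re].
  rewrite E in H2; left; destruct x as [u v]; simpl in *.
  assert (B : Rabs (- (alpha * s)) = s).
  { rewrite Rabs_Ropp, Rabs_mult, is_sign_Rabs, Rabs_right by (auto; lra); ring. }
  rewrite B, Rminus_diag, Rmax_left in H2 by lra.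
  rewrite Ropp_0, Rplus_0_r; lra.
Qed.

Lemma Re_a_p : Re a - Re p = 2 * (alpha * s).
Proof. unfold a, p; simpl; ring. Qed.

Lemma a_Vt tau : is_sign tau -> Vt tau a.
Proof.
  intros Ht; split; [rewrite Cmod_a; lra|]; apply tslit_re.
  intros E; assert (B := Re_a_p); assert (Z := alpha_s_neq_0); lra.
Qed.

Lemma path_integral_quotient tau (q : C -> C) (x : C) :
  is_sign tau -> (forall z, half_disc s rho delta tau z -> quotient z = q z) ->
  half_disc s rho delta tau x -> s < Rabs (Re x) ->
  path_integral (half_disc s rho delta tau) q a x =
  (quotient_primitive tau x - quotient_primitive tau a)%C.
Proof.
  intros Ht Hq Hx Hre.
  apply path_integral_primitive with (V := Vt tau) (Q := quotient); auto.
  - now apply primitive_quotient.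
  - intros z Hz; now apply continuous_quotient, (Vt_V tau).
  - intros z; now apply half_disc_Vt.
  - now apply a_Vt.
  - assert (B : alpha * Re x < - s \/ s < alpha * Re x).
    { unfold Rabs in Hre; destruct (Rcase_abs (Re x)), Ha as [E1|E1]; rewrite E1; lra. }
    destruct B as [B|B].
    + now apply conic_path.
    + now apply straight_path.
Qed.

(** [G] cancels, leaving the jumps of the logarithm at [x] and at [a]. For [alpha = 1] the jump at
    [a] is 0; for [alpha = -1] it is [2 pi i], but the two primitives are also exchanged. Thus the
    result has the same sign in both cases, which matches the exchange of the two domains in the
    definition. *)
Lemma quotient_primitive_diff (x : C) : Re x <> Re p ->
  ((quotient_primitive alpha x - quotient_primitive alpha a) -
   (quotient_primitive (- alpha) x - quotient_primitive (- alpha) a))%C =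
  (if Rlt_dec (alpha * Re x) (- s) then RtoC (2 * PI) * Ci * d else 0)%C.
Proof.
  intros Hx.
  assert (B := Re_a_p).
  assert (Dx := slog_diff (x - p)%C); assert (Da := slog_diff (a - p)%C).
  assert (Ex : fst (x - p)%C = Re x - Re p) by (destruct x; reflexivity).
  assert (Ea : fst (a - p)%C = Re a - Re p) by reflexivity.
  rewrite Ex in Dx; rewrite Ea, B in Da.
  specialize (Dx ltac:(lra)).
  assert (Ep : Re p = - (alpha * s)) by reflexivity.
  unfold quotient_primitive; destruct Ha as [E1|E1]; rewrite E1 in Da, Ep |- *.
  - specialize (Da ltac:(lra)).
    replace (- (1)) with (-1) by ring.
    transitivity (d * ((slog 1 (x - p) - slog (-1) (x - p)) - (slog 1 (a - p) - slog (-1) (a - p))))%C;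
      [ring|].
    rewrite Dx, Da.
    destruct (Rlt_dec (2 * (1 * s)) 0); [lra|].
    destruct (Rlt_dec (Re x - Re p) 0), (Rlt_dec (1 * Re x) (- s)); try lra; ring.
  - specialize (Da ltac:(lra)).
    replace (- -1) with 1 by ring.
    transitivity (d * ((slog 1 (a - p) - slog (-1) (a - p)) - (slog 1 (x - p) - slog (-1) (x - p))))%C;
      [ring|].
    rewrite Dx, Da.
    destruct (Rlt_dec (2 * (-1 * s)) 0); [|lra].
    destruct (Rlt_dec (Re x - Re p) 0), (Rlt_dec (-1 * Re x) (- s)); try lra; ring.
Qed.

Lemma is_residue_quotient_p : is_residue quotient p d.
Proof.
  apply (is_residue_primitive V G) with (r0 := X - s); auto; [lra| |].
  - intros z Hz; split.
    + replace z with (z - p + p)%C by ring.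
      eapply Rle_lt_trans; [apply Cmod_triangle|]; rewrite Cmod_p; lra.
    + intros ->; replace (p - p)%C with (RtoC 0) in Hz by ring; rewrite Cmod_0 in Hz; lra.
  - exact continuous_quotient.
Qed.

(** The cut of [slog] lies on the vertical line through [p], at distance [2 s] from [a], so the
    quotient itself has a primitive around [a]. *)
Lemma is_residue_quotient_a : is_residue quotient a 0%C.
Proof.
  assert (S1 : is_sign 1) by now left.
  apply (is_residue_primitive (Vt 1) (quotient_primitive 1)) with (r0 := Rmin (2 * s) (X - s)).
  - apply Rmin_pos; lra.
  - intros z Hz; assert (M1 := Rmin_l (2 * s) (X - s)); assert (M2 := Rmin_r (2 * s) (X - s)).
    split.
    + replace z with (z - a + a)%C by ring.
      eapply Rle_lt_trans; [apply Cmod_triangle|]; rewrite Cmod_a; lra.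
    + apply tslit_re; intros E.
      assert (B := Re_a_p); assert (R1 := re_le_Cmod (z - a)%C).
      replace (Re (z - a)%C) with (- (2 * (alpha * s))) in R1.
      2:{ destruct z as [u v]; simpl in *; lra. }
      rewrite Rabs_Ropp, !Rabs_mult, (is_sign_Rabs alpha), !Rabs_right in R1 by (auto; lra); lra.
  - generalize (primitive_quotient 1 S1); apply primitive_ext; intros x _.
    unfold Cdiv; ring.
  - intros z Hz; now apply continuous_quotient, (Vt_V 1).
Qed.

Lemma half_disc_ball tau (x : C) : is_sign tau ->
  Cmod (x - (0, tau * (rho / 2))%R)%C < rho / 4 -> half_disc s rho delta tau x.
Proof.
  intros Ht Hx; destruct x as [u v].
  replace ((u, v) - (0, tau * (rho / 2))%R)%C with (u, v - tau * (rho / 2)) in Hx.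
  2:{ unfold Cminus, Cplus, Copp; simpl; f_equal; ring. }
  apply Cmod_lt_sqr in Hx; [|lra].
  assert (V1 : - (rho / 4) < v - tau * (rho / 2) < rho / 4) by (split; nra).
  apply half_disc_upper; try lra.
  - destruct Ht as [-> | ->]; nra.
  - destruct Ht as [-> | ->]; lra.
Qed.

Lemma Res_quotient tau (q : C -> C) (c v : C) :
  is_sign tau -> (forall z, half_disc s rho delta tau z -> quotient z = q z) ->
  is_residue quotient c v -> Res (half_disc s rho delta tau) q c = v.
Proof.
  intros Ht Hq Hv.
  apply (Res_eq _ quotient q c v (0, tau * (rho / 2)) (rho / 4)); auto; [lra| |].
  - intros x Hx; now apply half_disc_ball.
  - apply is_rational_quotient.
Qed.

End Quotient.

(** * Stokes matrices *)

Lemma zpow_neg (z : C) (k : nat) : z <> 0%C -> zpow z (- Z.of_nat k) = ((/ z) ^ k)%C.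
Proof. intros Hz; now rewrite zpow_opp, Cpow_inv. Qed.

Lemma Cdiv_neq_0 (u v : C) : u <> 0%C -> v <> 0%C -> (u / v)%C <> 0%C.
Proof.
  intros Hu Hv E; apply Hu; replace u with (u / v * v)%C by (field; auto).
  rewrite E; ring.
Qed.

(** The factor [1 / ((x - a) (x - p))] coming from [Phi_2] lowers the exponent [|m|] at [a] to
    [|m| - 1], a natural number since [m <> 0], and raises the pole order at [p] to [|m| + 1]. The
    power of [-1] comes from replacing the outer quotient, or its inverse, by
    [(x + e) / (x - e)]. *)
Lemma quotient_form (s X alpha es : R) (K : C) (m n : Z) :
  m <> 0%Z ->
  (alpha = 1 /\ (0 < m)%Z \/ alpha = -1 /\ (m < 0)%Z) ->
  (es = 1 /\ (0 <= n)%Z \/ es = -1 /\ (n < 0)%Z) ->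
  forall x : C, (x - RtoC s <> 0)%C -> (x + RtoC s <> 0)%C ->
    (RtoC X - x <> 0)%C -> (RtoC X + x <> 0)%C ->
  (K * (zpow (ratio s x) m * zpow (outer X x) n) / ((x - RtoC s) * (x + RtoC s)))%C =
  quotient s X alpha es (K * (- (1)) ^ Z.abs_nat n)%C (Z.abs_nat m - 1) (Z.abs_nat n) x.
Proof.
  intros Hm Ha He x H1 H2 H3 H4.
  assert (A1 : alpha = 1 \/ alpha = -1) by tauto.
  assert (A2 : es = 1 \/ es = -1) by tauto.
  set (a := RtoC (alpha * s)); set (p := RtoC (- (alpha * s))); set (e := RtoC (es * X)).
  assert (Hp : (x - p <> 0)%C).
  { intros E; destruct A1; subst; [apply H2 | apply H1]; rewrite <- E; unfold p;
      rewrite RtoC_opp, RtoC_mult; ring. }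
  assert (Hae : (x - a <> 0)%C).
  { intros E; destruct A1; subst; [apply H1 | apply H2]; rewrite <- E; unfold a;
      rewrite RtoC_mult; ring. }
  assert (Hee : (x - e <> 0)%C).
  { intros E; destruct A2; subst; [apply H3 | apply H4].
    - replace (RtoC X - x)%C with (- (x - e))%C by (unfold e; rewrite RtoC_mult; ring).
      rewrite E; ring.
    - rewrite <- E; unfold e; rewrite RtoC_mult; ring. }
  assert (E1 : (K * (zpow (ratio s x) m * zpow (outer X x) n) / ((x - RtoC s) * (x + RtoC s)))%C =
    (K * (((x - a) * / (x - p)) ^ Z.abs_nat m * (- (1) * ((x + e) * / (x - e))) ^ Z.abs_nat n)
      / ((x - a) * (x - p)))%C).
  { replace ((x - RtoC s) * (x + RtoC s))%C with ((x - a) * (x - p))%C.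
    2:{ unfold a, p; destruct A1; subst alpha; rewrite RtoC_opp, RtoC_mult; ring. }
    assert (Ez : zpow (ratio s x) m = (((x - a) * / (x - p)) ^ Z.abs_nat m)%C).
    { destruct Ha as [[-> Ha]|[-> Ha]].
      - replace (zpow (ratio s x) m) with (zpow (ratio s x) (Z.of_nat (Z.abs_nat m)))
          by (f_equal; lia).
        rewrite zpow_nat; apply (f_equal (fun z => Cpow z _)); unfold ratio, a, p.
        rewrite Rmult_1_l, RtoC_opp; field; auto.
        now replace (x - - RtoC s)%C with (x + RtoC s)%C by ring.
      - replace (zpow (ratio s x) m) with (zpow (ratio s x) (- Z.of_nat (Z.abs_nat m)))
          by (f_equal; lia).
        rewrite zpow_neg by now apply Cdiv_neq_0.
        apply (f_equal (fun z => Cpow z _)); unfold ratio.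
        replace (x - a)%C with (x + RtoC s)%C by (unfold a; rewrite RtoC_mult; ring).
        replace (x - p)%C with (x - RtoC s)%C by (unfold p; rewrite RtoC_opp, RtoC_mult; ring).
        field; auto. }
    assert (Eo : zpow (outer X x) n = ((- (1) * ((x + e) * / (x - e))) ^ Z.abs_nat n)%C).
    { destruct He as [[-> He]|[-> He]].
      - replace (zpow (outer X x) n) with (zpow (outer X x) (Z.of_nat (Z.abs_nat n)))
          by (f_equal; lia).
        rewrite zpow_nat; apply (f_equal (fun z => Cpow z _)); unfold outer.
        replace (x + e)%C with (RtoC X + x)%C by (unfold e; rewrite RtoC_mult; ring).
        replace (x - e)%C with (- (RtoC X - x))%C by (unfold e; rewrite RtoC_mult; ring).
        field; exact H3.
      - replace (zpow (outer X x) n) with (zpow (outer X x) (- Z.of_nat (Z.abs_nat n)))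
          by (f_equal; lia).
        rewrite zpow_neg by now apply Cdiv_neq_0.
        apply (f_equal (fun z => Cpow z _)); unfold outer.
        replace (x + e)%C with (- (RtoC X - x))%C by (unfold e; rewrite RtoC_mult; ring).
        replace (x - e)%C with (RtoC X + x)%C by (unfold e; rewrite RtoC_mult; ring).
        field; auto. }
    now rewrite Ez, Eo. }
  rewrite E1; unfold quotient, bimonomial.
  fold a; fold p; fold e.
  rewrite !zpow_opp, !Cpow_mult_l, !Cpow_inv by auto.
  replace (Z.abs_nat m) with (S (Z.abs_nat m - 1)) at 1 2 by lia.
  set (k := (Z.abs_nat m - 1)%nat); simpl.
  assert (P1 := Cpow_nz _ k Hp); assert (P2 := Cpow_nz _ (Z.abs_nat n) Hee).
  field; auto.
Qed.

Lemma iota_series_two (u : nat -> C) : (forall k, (2 <= k)%nat -> u k = 0%C) ->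
  iota (T := C_R_CompleteNormedModule) (fun l : C => is_series (V := C_R_NormedModule) u l)
  = (u 0%nat + u 1%nat)%C.
Proof.
  intros Hu.
  assert (S1 : is_series (V := C_R_NormedModule) u (u 0%nat + u 1%nat)%C).
  { apply (filterlim_ext_loc (fun _ => (u 0%nat + u 1%nat)%C)).
    - exists 1%nat; intros k Hk; induction Hk as [|k Hk IH].
      + now rewrite sum_Sn, sum_O.
      + rewrite sum_Sn, <- IH, (Hu (S k)) by lia; symmetry; apply Cplus_0_r.
    - apply filterlim_const. }
  apply (iota_unique (V := C_R_CompleteNormedModule)); auto.
  intros y Hy.
  exact (filterlim_locally_unique (V := C_R_NormedModule) (F := eventually) _ _ _ Hy S1).
Qed.

Lemma entry_mat2 (a b c d : C) (i j : nat) : (i < 2)%nat -> (j < 2)%nat ->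
  entry (mat2 a b c d) i j =
  match i, j with O, O => a | O, _ => b | _, O => c | _, _ => d end.
Proof. intros Hi Hj; destruct i as [|[|i]], j as [|[|j]]; try lia; reflexivity. Qed.

(** The matrix is nilpotent of order 2, so the exponential series stops after its linear term. *)
Lemma exp_2piT_eq (d : C) : exp_2piT d = mat2 1 (RtoC (2 * PI) * Ci * d)%C 0 1.
Proof.
  unfold exp_2piT; set (c := (RtoC (2 * PI) * Ci)%C).
  set (A := mat2_scal c (Tmat d)).
  assert (EA : A = mat2 0 (c * d)%C 0 0).
  { change A with (mat2 (c * 0)%C (c * d)%C (c * 0)%C (c * 0)%C).
    now rewrite Cmult_0_r. }
  set (pw := pow_n (K := @matrix_Ring C_Ring 2) A).
  assert (P0 : pw 0%nat = mat2 1 0 0 1) by reflexivity.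
  assert (PS : forall k, pw (S k) = Mmult (T := C_Ring) A (pw k)) by reflexivity.
  assert (P1 : pw 1%nat = mat2 0 (c * d)%C 0 0).
  { rewrite PS, P0, EA, Mmult_mat2; f_equal; ring. }
  assert (P2 : forall k, pw (S (S k)) = mat2 0 0 0 0).
  { induction k as [|k IH].
    - rewrite PS, P1, EA, Mmult_mat2; f_equal; ring.
    - rewrite PS, IH, EA, Mmult_mat2; f_equal; ring. }
  unfold mexp, mat2 at 1; apply mk_matrix_ext; intros i j Hi Hj; fold pw.
  rewrite iota_series_two.
  - rewrite P0, P1, !entry_mat2 by auto.
    destruct i as [|i], j as [|j]; simpl; field; intros E; injection E; lra.
  - intros [|[|k]] Hk; try lia; rewrite P2, entry_mat2 by auto.
    destruct i as [|i], j as [|j]; unfold Cdiv; ring.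
Qed.

(** Once the diagonals coincide, the Stokes matrix sees only the difference of the integrals. *)
Lemma Stokes_triangular (u v I1 I2 : C) : u <> 0%C -> v <> 0%C ->
  Mmult (T := C_Ring) (Minv2 (mat2 u (u * I1)%C 0 v)) (mat2 u (u * I2)%C 0 v) =
  mat2 1 (I2 - I1)%C 0 1.
Proof.
  intros Hu Hv; unfold Minv2; rewrite Mmult_mat2; unfold det2; rewrite !entry_mat2 by auto.
  f_equal; field; repeat split; auto.
Qed.

(** Equality of predicates rather than equivalence, since domains are arguments of [Psi] and
    [Res]. *)
Lemma Omega_up_half_disc eps rho delta :
  Omega_up eps rho delta = half_disc (sqrt eps) rho delta 1.
Proof.
  apply functional_extensionality; intros x; apply propositional_extensionality.
  unfold Omega_up, half_disc; rewrite Rmult_1_l; tauto.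
Qed.

Lemma Omega_down_half_disc eps rho delta :
  Omega_down eps rho delta = half_disc (sqrt eps) rho delta (-1).
Proof.
  apply functional_extensionality; intros x; apply propositional_extensionality.
  unfold Omega_down, half_disc; split; intros [H1 H2]; split; lra.
Qed.

(** * Both orders of the domains, in terms of the sign of [b2 - b1] *)

Section Core.
Variables (eps rho delta alpha : R) (b1 b2 g1 g2 : C) (m n : Z).
Variables (phi1_1 phi2_1 phi1_2 phi2_2 : C -> C).
Let s := sqrt eps.
Let X := 1 / sqrt eps.
Let O1 := half_disc s rho delta (- alpha).
Let O2 := half_disc s rho delta alpha.
Hypotheses (He : 0 < eps < 1) (Hrho : s < rho < X) (Hd : 0 < delta).
Hypothesis Hm : ((b2 - b1) / RtoC (2 * sqrt eps))%C = RtoC (IZR m).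
Hypothesis Hn : ((g2 - g1) / RtoC (2 * sqrt eps))%C = RtoC (IZR n).
Hypothesis Hm0 : m <> 0%Z.
Hypothesis Ha : alpha = 1 /\ (0 < m)%Z \/ alpha = -1 /\ (m < 0)%Z.
Hypothesis H11 : Phi1_branch eps b1 g1 O1 phi1_1.
Hypothesis H21 : Phi2_branch eps b2 g2 O1 phi2_1.
Hypothesis H12 : Phi1_branch eps b1 g1 O2 phi1_2.
Hypothesis H22 : Phi2_branch eps b2 g2 O2 phi2_2.
Hypothesis Hbase : forall x : C, O1 x -> O2 x -> s < alpha * Re x ->
  phi1_1 x = phi1_2 x /\ phi2_1 x = phi2_2 x.

Lemma s_pos : 0 < s.
Proof. apply sqrt_lt_R0; lra. Qed.

Lemma alpha_sign : is_sign alpha /\ is_sign (- alpha).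
Proof. destruct Ha as [[-> _]|[-> _]]; split; unfold is_sign; lra. Qed.

(** A real point next to the base point, common to both half-discs, at which the constants of the
    two branches are compared. *)
Lemma half_disc_axis_point tau : is_sign tau ->
  half_disc s rho delta tau (RtoC (alpha * ((s + rho) / 2))).
Proof.
  intros Ht; assert (P := s_pos); split; simpl.
  - rewrite Cmod_R, Rabs_mult, (is_sign_Rabs alpha), Rabs_right by (try apply alpha_sign; lra); lra.
  - rewrite Rabs_mult, (is_sign_Rabs alpha), Rabs_right by (try apply alpha_sign; lra).
    rewrite Rmax_right by lra.
    assert (0 < delta * (1 * ((s + rho) / 2) - s)) by (apply Rmult_lt_0_compat; lra); lra.
Qed.

Lemma Phi1_explicit tau phi : is_sign tau ->
  Phi1_branch eps b1 g1 (half_disc s rho delta tau) phi ->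
  exists K : C, K <> 0%C /\ forall x, half_disc s rho delta tau x -> phi x =
    (K * Cexp (ratio_log s X (b1 / RtoC (2 * sqrt eps)) (g1 / RtoC (2 * sqrt eps)) x))%C.
Proof.
  intros Ht [f [h [Hf [Hh E]]]]; assert (P := s_pos).
  destruct (phi1_explicit s rho delta tau ltac:(lra) Hd Ht X ltac:(lra) _ _ _ _ Hf Hh)
    as [K [HK EK]].
  exists K; split; auto; intros x Hx; now rewrite E, EK.
Qed.

Lemma Phi2_explicit tau phi : is_sign tau ->
  Phi2_branch eps b2 g2 (half_disc s rho delta tau) phi ->
  exists K : C, K <> 0%C /\ forall x, half_disc s rho delta tau x -> phi x =
    (K * Cexp (ratio_log s X (b2 / RtoC (2 * sqrt eps)) (g2 / RtoC (2 * sqrt eps)) x)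
     / ((x - RtoC s) * (x + RtoC s)))%C.
Proof.
  intros Ht [f1 [f2 [h [Hf1 [Hf2 [Hh E]]]]]]; assert (P := s_pos).
  destruct (phi2_explicit s rho delta tau ltac:(lra) Hd Ht X ltac:(lra) _ _ _ _ _ Hf1 Hf2 Hh)
    as [K [HK EK]].
  exists K; split; auto; intros x Hx; now rewrite E, EK.
Qed.

(** The number [d] is the one delivered by partial fractions; the two residue claims identify the
    off-diagonal entry on either side. *)
Lemma Stokes_core : exists d : C,
  (forall x, O1 x -> O2 x -> s < Rabs (Re x) ->
    Stokes (Psi O1 phi1_1 phi2_1 (RtoC (alpha * s))) (Psi O2 phi1_2 phi2_2 (RtoC (alpha * s))) x =
    mat2 1 (if Rlt_dec (alpha * Re x) (- s) then RtoC (2 * PI) * Ci * d else 0)%C 0 1) /\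
  Res O1 (fun x => phi2_1 x / phi1_1 x)%C (RtoC (- (alpha * s))) = d /\
  Res O1 (fun x => phi2_1 x / phi1_1 x)%C (RtoC (alpha * s)) = 0%C.
Proof.
  assert (P := s_pos); destruct alpha_sign as [S1 S2].
  destruct (Phi1_explicit _ _ S2 H11) as [K1 [N1 E1]].
  destruct (Phi1_explicit _ _ S1 H12) as [K1' [N1' E1']].
  destruct (Phi2_explicit _ _ S2 H21) as [K2 [N2 E2]].
  destruct (Phi2_explicit _ _ S1 H22) as [K2' [N2' E2']].
  set (L1 := ratio_log s X (b1 / RtoC (2 * sqrt eps)) (g1 / RtoC (2 * sqrt eps))) in *.
  set (L2 := ratio_log s X (b2 / RtoC (2 * sqrt eps)) (g2 / RtoC (2 * sqrt eps))) in *.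
  assert (NZ : forall tau x, is_sign tau -> half_disc s rho delta tau x ->
    (x - RtoC s <> 0)%C /\ (x + RtoC s <> 0)%C /\ (RtoC X - x <> 0)%C /\ (RtoC X + x <> 0)%C).
  { intros tau x Ht Hx; repeat split.
    - now apply (half_disc_minus_neq_0 s rho delta tau).
    - now apply (half_disc_plus_neq_0 s rho delta tau).
    - apply (disc_neq s rho) with (X := X); try lra; apply Hx.
    - replace (RtoC X + x)%C with (RtoC X - - x)%C by ring.
      apply (disc_neq s rho); try lra; rewrite Cmod_opp; apply Hx. }
  assert (EK : K1 = K1' /\ K2 = K2').
  { set (x0 := RtoC (alpha * ((s + rho) / 2))).
    assert (X1 : O1 x0) by now apply half_disc_axis_point.
    assert (X2 : O2 x0) by now apply half_disc_axis_point.
    destruct (Hbase x0 X1 X2) as [B1 B2].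
    { unfold x0; simpl; rewrite <- Rmult_assoc, is_sign_sq by auto; lra. }
    rewrite (E1 _ X1), (E1' _ X2) in B1; rewrite (E2 _ X1), (E2' _ X2) in B2.
    destruct (NZ _ _ S1 X2) as [Z1 [Z2 _]].
    assert (C1 := Cexp_neq_0 (L1 x0)); assert (C2 := Cexp_neq_0 (L2 x0)).
    split.
    - transitivity (K1 * Cexp (L1 x0) / Cexp (L1 x0))%C; [field; auto|].
      rewrite B1; field; auto.
    - transitivity (K2 * Cexp (L2 x0) / ((x0 - RtoC s) * (x0 + RtoC s))
        * ((x0 - RtoC s) * (x0 + RtoC s)) / Cexp (L2 x0))%C; [field; auto|].
      rewrite B2; field; auto. }
  destruct EK as [<- <-].
  assert (Hes : exists es : R, es = 1 /\ (0 <= n)%Z \/ es = -1 /\ (n < 0)%Z).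
  { destruct (Z_le_dec 0 n); [exists 1 | exists (-1)]; [left|right]; split; auto; lia. }
  destruct Hes as [es Hes].
  assert (S3 : is_sign es) by (unfold is_sign; tauto).
  set (K := (K2 / K1 * (- (1)) ^ Z.abs_nat n)%C).
  set (N := (Z.abs_nat m - 1)%nat); set (n' := Z.abs_nat n).
  set (Q := quotient s X alpha es K N n').
  assert (EQ : forall tau x, is_sign tau -> half_disc s rho delta tau x ->
    Q x = (K2 * Cexp (L2 x) / ((x - RtoC s) * (x + RtoC s)) / (K1 * Cexp (L1 x)))%C).
  { intros tau x Ht Hx; destruct (NZ _ _ Ht Hx) as [Z1 [Z2 [Z3 Z4]]].
    unfold Q, K, N, n'; rewrite <- (quotient_form s X alpha es (K2 / K1)%C m n) by auto.
    (* Resonance: the exponents differ by the integers [m] and [n], so the exponential of the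
       difference consists of integer powers and no longer depends on the choice of logarithms. *)
    assert (EL : L2 x = (L1 x + (RtoC (IZR m) * Clog (ratio s x) + RtoC (IZR n) * Clog (outer X x)))%C).
    { rewrite <- Hm, <- Hn; unfold L1, L2, ratio_log; field.
      intros E; injection E; unfold s in P; lra. }
    rewrite EL, !Cexp_add, !Cexp_zpow, !Cexp_Clog.
    - assert (C1 := Cexp_neq_0 (L1 x)); field; auto.
    - apply (slit_outer s rho); try lra; apply Hx.
    - now apply (slit_ratio s rho delta tau). }
  assert (Hsr : 0 < s < rho) by lra.
  destruct Hrho as [_ HX].
  destruct (log_primitive_quotient s rho X alpha es K N n' Hsr HX S1 S3) as [d [G HG]].
  exists d; repeat split.
  - intros x X1 X2 Hre.
    unfold Stokes, Psi.
    rewrite (E1 _ X1), (E1' _ X2), (E2 _ X1), (E2' _ X2).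
    destruct (NZ _ _ S1 X2) as [Z1 [Z2 _]].
    rewrite Stokes_triangular.
    2:{ apply Cmult_neq_0; auto; apply Cexp_neq_0. }
    2:{ apply Cdiv_neq_0; apply Cmult_neq_0; auto; apply Cexp_neq_0. }
    rewrite (path_integral_quotient s rho X delta alpha es K N n' Hsr HX Hd S1 S3 d G HG alpha); auto.
    2:{ intros z Hz; rewrite (E1' _ Hz), (E2' _ Hz); now apply (EQ alpha). }
    rewrite (path_integral_quotient s rho X delta alpha es K N n' Hsr HX Hd S1 S3 d G HG (- alpha)); auto.
    2:{ intros z Hz; rewrite (E1 _ Hz), (E2 _ Hz); now apply (EQ (- alpha)). }
    rewrite (quotient_primitive_diff s rho alpha Hsr S1 d G); auto.
    simpl; intros E; rewrite E, Rabs_Ropp, Rabs_mult, is_sign_Rabs, Rabs_right in Hre by (auto; lra); lra.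
  - apply (Res_quotient s rho X delta alpha es K N n'); auto.
    + intros z Hz; rewrite (E1 _ Hz), (E2 _ Hz); now apply (EQ (- alpha)).
    + now apply (is_residue_quotient_p s rho X alpha es K N n') with (G := G).
  - apply (Res_quotient s rho X delta alpha es K N n'); auto.
    + intros z Hz; rewrite (E1 _ Hz), (E2 _ Hz); now apply (EQ (- alpha)).
    + now apply (is_residue_quotient_a s rho X alpha es K N n') with (d := d) (G := G).
Qed.

End Core.

Theorem corollary5p2 :
  forall (eps rho delta : R) (b1 b2 g1 g2 : C)
         (phi1_1 phi2_1 phi1_2 phi2_2 : C -> C),
  let O1 := Omega1 eps rho delta b1 b2 in
  let O2 := Omega2 eps rho delta b1 b2 in
  let xstar := RtoC (base_point eps b1 b2) in
  let St := Stokes (Psi O1 phi1_1 phi2_1 xstar) (Psi O2 phi1_2 phi2_2 xstar) in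
  let d := fun a : R => Res O1 (fun x => phi2_1 x / phi1_1 x)%C (RtoC a) in
  0 < eps < 1 ->
  sqrt eps < rho < 1 / sqrt eps ->
  0 < delta ->
  b1 <> b2 ->
  double_resonance eps b1 b2 g1 g2 ->
  Phi1_branch eps b1 g1 O1 phi1_1 ->
  Phi2_branch eps b2 g2 O1 phi2_1 ->
  Phi1_branch eps b1 g1 O2 phi1_2 ->
  Phi2_branch eps b2 g2 O2 phi2_2 ->
  (forall x : C, Omega_base eps rho delta b1 b2 x ->
     phi1_1 x = phi1_2 x /\ phi2_1 x = phi2_2 x) ->
  (forall x : C, Omega_L eps rho delta b1 b2 x -> St x = exp_2piT (d (xL eps))) /\
  (forall x : C, Omega_R eps rho delta b1 b2 x -> St x = exp_2piT (d (xR eps))).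
Proof.
  intros eps rho delta b1 b2 g1 g2 phi1_1 phi2_1 phi1_2 phi2_2 O1 O2 xstar St d
    He Hrho Hd Hb [[m Hm] [n Hn]] H11 H21 H12 H22 Hbase.
  assert (P : 0 < sqrt eps) by (apply sqrt_lt_R0; lra).
  (* The difference is real with the sign of [m], which settles every sign test in the
     definitions. *)
  assert (Eb : (b2 - b1)%C = RtoC (2 * sqrt eps * IZR m)).
  { rewrite RtoC_mult, <- Hm; field.
    intros E; injection E; lra. }
  assert (Hm0 : m <> 0%Z).
  { intros ->; apply (Cminus_neq_0 b2 b1); auto; rewrite Eb, Rmult_0_r; reflexivity. }
  assert (Eb' : (b1 - b2)%C = RtoC (- (2 * sqrt eps * IZR m))).
  { rewrite RtoC_opp, <- Eb; ring. }
  destruct (Z_lt_le_dec 0 m) as [Lm|Lm].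
  - assert (0 < 2 * sqrt eps * IZR m).
    { apply Rmult_lt_0_compat; [lra|]; now apply IZR_lt. }
    subst St d O1 O2 xstar.
    unfold Omega_base, Omega_L, Omega_R, Omega1, Omega2, base_point in *.
    rewrite Eb, Eb' in *; change (Re (RtoC ?z)) with z in *.
    destruct (Rlt_dec 0 (2 * sqrt eps * IZR m)); [|lra].
    destruct (Rlt_dec 0 (- (2 * sqrt eps * IZR m))); [lra|].
    rewrite Omega_up_half_disc, Omega_down_half_disc in *.
    assert (core := Stokes_core eps rho delta (1) b1 b2 g1 g2 m n phi1_1 phi2_1 phi1_2 phi2_2).
    replace (- (1)) with (-1) in core by ring.
    destruct core as [c [HS [Rp Ra]]]; auto.
    + now rewrite Eb.
    + intros x X1 X2 Hx; apply Hbase; repeat split; try apply X1; try apply X2;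
        unfold xL, xR; lra.
    (* Base point [xR]: the jump occurs at [xL], and at [xR] the residue 0 makes the exponential the
       identity. *)
    + rewrite Rmult_1_l in *; unfold xL, xR; rewrite Rp, Ra, !exp_2piT_eq.
      split; intros x [X1 [X2 Hx]]; unfold xL, xR in Hx; rewrite HS; auto.
      * destruct (Rlt_dec _ _); [reflexivity|]; lra.
      * rewrite Rabs_left; lra.
      * destruct (Rlt_dec _ _); [lra|]; now rewrite Cmult_0_r.
      * rewrite Rabs_right; lra.
  - assert (0 < - (2 * sqrt eps * IZR m)).
    { replace (- (2 * sqrt eps * IZR m)) with (2 * sqrt eps * IZR (- m)) by (rewrite opp_IZR; ring).
      apply Rmult_lt_0_compat; [lra|]; apply IZR_lt; lia. }
    subst St d O1 O2 xstar.
    unfold Omega_base, Omega_L, Omega_R, Omega1, Omega2, base_point in *.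
    rewrite Eb, Eb' in *; change (Re (RtoC ?z)) with z in *.
    destruct (Rlt_dec 0 (2 * sqrt eps * IZR m)); [lra|].
    destruct (Rlt_dec 0 (- (2 * sqrt eps * IZR m))); [|lra].
    rewrite Omega_up_half_disc, Omega_down_half_disc in *.
    assert (core := Stokes_core eps rho delta (-1) b1 b2 g1 g2 m n phi1_1 phi2_1 phi1_2 phi2_2).
    replace (- (-1)) with 1 in core by ring.
    destruct core as [c [HS [Rp Ra]]]; auto.
    + now rewrite Eb.
    + right; split; auto; lia.
    + intros x X1 X2 Hx; apply Hbase; repeat split; try apply X1; try apply X2;
        unfold xL, xR; lra.
    + replace (-1 * sqrt eps) with (- sqrt eps) in * by ring.
      rewrite Ropp_involutive in Rp; unfold xL, xR; rewrite Rp, Ra, !exp_2piT_eq.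
      split; intros x [X1 [X2 Hx]]; unfold xL, xR in Hx; rewrite HS; auto.
      * destruct (Rlt_dec _ _); [lra|]; now rewrite Cmult_0_r.
      * rewrite Rabs_left; lra.
      * destruct (Rlt_dec _ _); [reflexivity|]; lra.
      * rewrite Rabs_right; lra.
Qed.
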